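(* Let $N,n\geq 1$, let $\alpha_1,\dots,\alpha_N\in\mathbb{D}$ and let $v_1,\dots,v_N\in\mathbb{B}$, where $\mathbb{B}$ is the open unit ball of $\mathbb{C}^n$. There is a holomorphic map $f:\mathbb{D}\to\mathbb{B}$ such that $f(\alpha_k)=v_k$ for all $k=1,\dots,N$ if and only if for all $h_1,\dots,h_N\in\mathbb{C}$, $$\sum_{k,l=1}^{N}\overline{h}_k\,h_l\,\frac{1-\overline{v}_k\cdot v_l}{1-\overline{\alpha}_k\alpha_l}\ \ge 0 .$$
   Context: $\mathbb{D}$ is the open unit disc of $\mathbb{C}$. For $v,w\in\mathbb{C}^n$, $\overline v\cdot w=\sum_{m=1}^n\overline{v^m}\,w^m$, where $v^m$ denotes the $m$-th coordinate of $v$. *)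

(* Defs.v *)
From mathcomp Require Import all_boot all_order all_algebra.
From mathcomp Require Import complex.
From mathcomp Require Import all_classical all_reals all_analysis.

Set Implicit Arguments.
Unset Strict Implicit.
Unset Printing Implicit Defensive.

Import Order.TTheory GRing.Theory Num.Theory.
Import numFieldNormedType.Exports.

Local Open Scope classical_set_scope.
Local Open Scope ring_scope.

(* The definitions are stated over a numClosedFieldType so that the topology
   that MathComp-Analysis puts on every numFieldType is inferred; they are meant
   for C := R[i] with R : realType. *)

(* Conjugate-linear in the first argument. *)
Definition cdot (C : numClosedFieldType) (n : nat) (v w : 'rV[C]_n) : C :=
  \sum_(m < n) (v 0 m)^* * w 0 m.

Definition unit_disc {C : numClosedFieldType} : set C := [set z | `|z| < 1].

(* The Euclidean ball: the library norm on 'rV[C]_n is the sup norm, whose unit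
   ball is a polydisc. *)
Definition unit_ball {C : numClosedFieldType} {n : nat} : set 'rV[C]_n :=
  [set v | \sum_(m < n) `|v 0 m| ^+ 2 < 1].

(* Here C is a normed module over itself, so derivable f z 1 is complex
   differentiability of f at z. Only the values of f on U are relevant, provided
   U is open. *)
Definition holomorphic_map (C : numClosedFieldType) (n : nat)
    (U : set C) (V : set 'rV[C]_n) (f : C -> 'rV[C]_n) : Prop :=
  forall z, U z -> V (f z) /\ derivable f z 1.

(* Main.v *)
Require Import Defs.
From mathcomp Require Import all_boot all_order all_algebra.
From mathcomp Require Import complex ring lra.
From mathcomp Require Import all_classical all_reals all_analysis.

Import Order.TTheory GRing.Theory Num.Theory.
Import numFieldNormedType.Exports.

Local Open Scope classical_set_scope.
Local Open Scope ring_scope.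

(** Both directions come from one algebraic identity, the Schur step. Pick a
    pivot node [alpha j] whose value [a = v j] lies in the open ball. Composing
    with the ball automorphism [ball_aut a], which sends [a] to 0, multiplies the
    entries [1 - cdot (v k) (v l)] by [c_k^* c_l] for nonzero numbers [c_k]
    ([ball_aut_kernel]); the disc kernel obeys the same law for the Blaschke
    factor [b] vanishing at [alpha j] ([blaschke_kernel]). Subtracting the second
    identity from the first splits the Pick form into the squared modulus of one
    linear functional plus the form with kernel
      [(b_k^* b_l - cdot (g_k) (g_l)) / (1 - alpha_k^* alpha_l)],
    where [g = ball_aut a v] ([schur_step]). The latter vanishes at the pivot and,
    when [g_k = b_k w_k], it is the Pick form of the data [w] evaluated at
    [b_k x_k]. So a Pick problem with a pivot is equivalent to a Pick problem
    without it, for values in the closed ball.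

    Sufficiency ([pick_interpolant_exists]) reads this backwards: from an
    interpolant [f1] of the reduced data one gets [ball_aut a (b f1)]. If the
    pivot value lies on the sphere, positivity forces all the values to agree and
    a constant map interpolates.

    Necessity ([pick_form_ge0]) needs that [g / b] still maps into the closed
    ball when [g] does and vanishes at the pivot: Schwarz's lemma. Instead of
    removing the singularity of [g / b] at the pivot, the induction carries a
    finite list of punctures [F]: maps are differentiable and bounded off [F],
    and the weights vanish at the nodes lying in [F], so repeated nodes need no
    special treatment. Punctures are harmless for the maximum principle because,
    for bounded [q], the function [q ^+ m * \prod_(p <- F) (z - p) ^+ 2] is
    differentiable at the punctures too; letting [m] grow absorbs the factor
    independent of [m] ([punctured_schwarz]).

    The maximum principle is derived from complex differentiability alone. For
    [h] differentiable on the disc, [h (exp (s + i t))] satisfies the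
    Cauchy-Riemann equations on the half-plane [s < 0] and is periodic in [t].
    Goursat's subdivision argument for the closed form [Im ds + Re dt]
    ([circulation_closed_form]) shows that the integral of the real part over one
    period does not depend on [s], and letting [s] go to minus infinity evaluates
    it at the centre ([Re_mean_value]). *)

Set Implicit Arguments.
Unset Strict Implicit.
Unset Printing Implicit Defensive.

(** * Circulation of a closed 1-form around a rectangle *)

(** The integrand is frozen outside the segment, so that it is continuous
    everywhere and the antiderivative is two-sided at the endpoints as well. *)
Lemma antiderivative_segment (R : realType) (g : R -> R) (a b : R) : a < b ->
  (forall x, a <= x <= b -> {for x, continuous g}) ->
  exists G : R -> R, forall x, a <= x <= b -> is_derive x 1 G (g x).
Proof.
move=> ab gc.
pose cl (x : R) := Num.max a (Num.min b x).
have clE x : a <= x <= b -> cl x = x.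
  by move=> /andP[ax xb]; rewrite /cl (min_idPr xb) (max_idPr ax).
have clab x : a <= cl x <= b.
  by rewrite /cl le_max lexx /= ge_max (ltW ab) ge_min lexx.
have clc : continuous cl.
  move=> x; apply: continuous_max; first exact: cst_continuous.
  by apply: continuous_min; [exact: cst_continuous|exact: cvg_id].
have hc : continuous (g \o cl).
  by move=> x; apply: continuous_comp; [exact: clc|apply: gc; exact: clab].
exists (fun y => \int[lebesgue_measure]_(t in [set` `[a - 1, y]]) (g \o cl) t)%R.
move=> x xab.
have [] := @continuous_FTC1_closed R (g \o cl) (a - 1) x (b + 1).
- by move/andP: xab => [_ xb]; rewrite (le_lt_trans xb)// ltrDl.
- apply: continuous_compact_integrable; first exact: segment_compact.
  exact: continuous_subspaceT.
- by move/andP: xab => [ax _]; rewrite (lt_le_trans _ ax)// ltrBlDr ltrDl.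
- exact: hc.
have -> : (g \o cl) x = g x by rewrite /comp clE.
move: (fun y : R => _) => F dF F'.
by apply: (DeriveDef dF); rewrite -derive1E F'.
Qed.

(** Antiderivatives as a function of the integrand, so that equal integrands get
    equal antiderivatives. *)
Lemma antiderivative_operator (R : realType) (a b : R) : a < b ->
  exists V : (R -> R) -> R -> R, forall g, (forall x, a <= x <= b -> {for x, continuous g}) ->
    forall x, a <= x <= b -> is_derive x 1 (V g) (g x).
Proof.
move=> ab.
have ex (g : R -> R) : exists G : R -> R, (forall x, a <= x <= b -> {for x, continuous g}) ->
    forall x, a <= x <= b -> is_derive x 1 G (g x).
  have [gc|ngc] := pselect (forall x, a <= x <= b -> {for x, continuous g}).
    by have [G hG] := antiderivative_segment ab gc; exists G.
  by exists id => /ngc.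
by have [V hV] := choice ex; exists V.
Qed.

Lemma derive_bound_variation (R : realType) (G g : R -> R) (a b e : R) : a <= b ->
  (forall x, a <= x <= b -> is_derive x 1 G (g x)) ->
  (forall x, a <= x <= b -> `|g x| <= e) ->
  `|G b - G a| <= e * (b - a).
Proof.
move=> ab dG ge.
have [| |c cab ->] := @MVT_segment _ G g a b ab.
- by move=> x; rewrite in_itv /= => /andP[/ltW ax /ltW xb]; apply: dG; rewrite ax xb.
- apply: derivable_within_continuous => x; rewrite in_itv /= => xab.
  by have [] := dG x xab.
rewrite in_itv /= in cab.
by rewrite normrM (ger0_norm (_ : 0 <= b - a)) ?subr_ge0// ler_wpM2r ?subr_ge0// ge.
Qed.

(** The integral of [P ds + Q dt] around the boundary of [[a, b] x [c, d]], where
    [U t] is an antiderivative of [P _ t] and [W s] one of [Q s _]. In terms of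
    antiderivatives, additivity under subdivision is an algebraic identity. *)
Definition circulation (R : realType) (U W : R -> R -> R) (a b c d : R) : R :=
  (U c b - U c a) - (U d b - U d a) + (W b d - W b c) - (W a d - W a c).

(** The affine part of [(P, Q)] at [(s0, t0)] has a symmetric cross term [p2], so
    it is the differential of a quadratic polynomial and contributes nothing; the
    remainder is at most [e] times the half-perimeter along each side. *)
Lemma circulation_small (R : realType) (P Q U W : R -> R -> R)
    (a b c d s0 t0 p1 p2 q2 e : R) :
  a <= s0 <= b -> c <= t0 <= d -> 0 <= e ->
  (forall s t, a <= s <= b -> c <= t <= d -> is_derive s 1 (U t) (P s t)) ->
  (forall s t, a <= s <= b -> c <= t <= d -> is_derive t 1 (W s) (Q s t)) ->
  (forall s t, a <= s <= b -> c <= t <= d ->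
    `|P s t - P s0 t0 - p1 * (s - s0) - p2 * (t - t0)| <= e * (`|s - s0| + `|t - t0|)) ->
  (forall s t, a <= s <= b -> c <= t <= d ->
    `|Q s t - Q s0 t0 - p2 * (s - s0) - q2 * (t - t0)| <= e * (`|s - s0| + `|t - t0|)) ->
  `|circulation U W a b c d| <= 2 * e * ((b - a) + (d - c)) ^+ 2.
Proof.
move=> /andP[as0 s0b] /andP[ct0 t0d] e0 dU dW PE QE.
have ab := le_trans as0 s0b; have cd := le_trans ct0 t0d.
set L := (b - a) + (d - c).
have distL s t : a <= s <= b -> c <= t <= d -> e * (`|s - s0| + `|t - t0|) <= e * L.
  move=> /andP[h1 h2] /andP[h3 h4]; apply: ler_wpM2l => //; apply: lerD; rewrite ler_norml; lra.
pose EU t s := U t s - (P s0 t0 * s + p1 * ((s - s0) ^+ 2 / 2) + p2 * (t - t0) * s).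
pose EW s t := W s t - (Q s0 t0 * t + p2 * (s - s0) * t + q2 * ((t - t0) ^+ 2 / 2)).
have bU t : c <= t <= d -> `|EU t b - EU t a| <= e * L * (b - a).
  move=> tcd; apply: (@derive_bound_variation _ (EU t)
    (fun s => P s t - P s0 t0 - p1 * (s - s0) - p2 * (t - t0))) => // s sab; last first.
    exact: le_trans (PE _ _ sab tcd) (distL _ _ sab tcd).
  have h := dU s t sab tcd.
  rewrite /EU; apply: is_derive_eq.
  rewrite /GRing.scale /=; by field.
have bW s : a <= s <= b -> `|EW s d - EW s c| <= e * L * (d - c).
  move=> sab; apply: (@derive_bound_variation _ (EW s)
    (fun t => Q s t - Q s0 t0 - p2 * (s - s0) - q2 * (t - t0))) => // t tcd; last first.
    exact: le_trans (QE _ _ sab tcd) (distL _ _ sab tcd).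
  have h := dW s t sab tcd.
  rewrite /EW; apply: is_derive_eq.
  rewrite /GRing.scale /=; by field.
have -> : circulation U W a b c d = (EU c b - EU c a) - (EU d b - EU d a)
    + (EW b d - EW b c) - (EW a d - EW a c).
  by rewrite /circulation /EU /EW; field.
have h1 := bU c; rewrite lexx cd in h1; have {}h1 := h1 isT.
have h2 := bU d; rewrite lexx cd in h2; have {}h2 := h2 isT.
have h3 := bW a; rewrite lexx ab in h3; have {}h3 := h3 isT.
have h4 := bW b; rewrite lexx ab in h4; have {}h4 := h4 isT.
have -> : 2 * e * L ^+ 2 = e * L * (b - a) + e * L * (b - a)
    + e * L * (d - c) + e * L * (d - c).
  by rewrite /L; ring.
apply: le_trans (ler_normB _ _) _; apply: lerD => //.
apply: le_trans (ler_normD _ _) _; apply: lerD => //.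
by apply: le_trans (ler_normB _ _) _; apply: lerD.
Qed.

Lemma bisect_circulation (R : realType) (U W : R -> R -> R) (a b c d k : R) :
  a <= b -> c <= d -> k < `|circulation U W a b c d| ->
  exists a' b' c' d', [/\ a <= a', a' <= b', b' <= b, b' - a' = (b - a) / 2 &
    [/\ c <= c', c' <= d', d' <= d, d' - c' = (d - c) / 2 &
    k / 4 < `|circulation U W a' b' c' d'|]].
Proof.
move=> ab cd kC; set m := (a + b) / 2; set n := (c + d) / 2.
have [am mb ma bm] : [/\ a <= m, m <= b, m - a = (b - a) / 2 & b - m = (b - a) / 2].
  by rewrite /m; split; [lra|lra|field|field].
have [cn nd nc dn] : [/\ c <= n, n <= d, n - c = (d - c) / 2 & d - n = (d - c) / 2].
  by rewrite /n; split; [lra|lra|field|field].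
have sum4 : circulation U W a b c d = circulation U W a m c n
    + circulation U W m b c n + (circulation U W a m n d + circulation U W m b n d).
  by rewrite /circulation; ring.
have [h|h1] := ltP (k / 4) `|circulation U W a m c n|; first by exists a, m, c, n.
have [h|h2] := ltP (k / 4) `|circulation U W m b c n|; first by exists m, b, c, n.
have [h|h3] := ltP (k / 4) `|circulation U W a m n d|; first by exists a, m, n, d.
have [h|h4] := ltP (k / 4) `|circulation U W m b n d|; first by exists m, b, n, d.
exfalso; move: kC; apply/negP; rewrite -leNgt sum4.
have := ler_normD (circulation U W a m c n + circulation U W m b c n)
  (circulation U W a m n d + circulation U W m b n d).
have := ler_normD (circulation U W a m c n) (circulation U W m b c n).
have := ler_normD (circulation U W a m n d) (circulation U W m b n d).
lra.
Qed.

Lemma nested_intervals (R : realType) (a b : nat -> R) :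
  (forall n, a n <= a n.+1) -> (forall n, b n.+1 <= b n) -> (forall n, a n <= b n) ->
  exists x, forall n, a n <= x <= b n.
Proof.
move=> ha hb ab.
have aD i j : (i <= j)%N -> a i <= a j by apply: (homo_leq (@lexx _ _) le_trans).
have bD i j : (i <= j)%N -> b j <= b i.
  by apply: (@homo_leq _ b (fun x y => y <= x)) => // x y z xy yz; exact: le_trans yz xy.
have abD i j : a i <= b j.
  have [ij|ji] := leqP i j; first exact: le_trans (aD _ _ ij) (ab j).
  exact: le_trans (ab i) (bD _ _ (ltnW ji)).
have ne : range a !=set0 by exists (a 0%N); exists 0%N.
exists (sup (range a)) => n; apply/andP; split.
  apply: sup_upper_bound; last by exists n.
  by split => //; exists (b 0%N) => _ [i _ <-].
by apply: ge_sup => // _ [i _ <-].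
Qed.

(** Goursat's theorem: quartering keeps a subrectangle whose circulation decays no
    faster than the square of its size, which contradicts [circulation_small] at
    the common point of the nested rectangles. No continuity of the partial
    derivatives is assumed. *)
Lemma circulation_closed_form (R : realType) (P Q U W : R -> R -> R) (a b c d : R) :
  a <= b -> c <= d ->
  (forall s t, a <= s <= b -> c <= t <= d -> is_derive s 1 (U t) (P s t)) ->
  (forall s t, a <= s <= b -> c <= t <= d -> is_derive t 1 (W s) (Q s t)) ->
  (forall s0 t0, a <= s0 <= b -> c <= t0 <= d -> exists p1 p2 q2 : R,
    forall e : R, 0 < e -> exists2 r : R, 0 < r & forall s t : R, `|s - s0| + `|t - t0| < r ->
    `|P s t - P s0 t0 - p1 * (s - s0) - p2 * (t - t0)| <= e * (`|s - s0| + `|t - t0|) /\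
    `|Q s t - Q s0 t0 - p2 * (s - s0) - q2 * (t - t0)| <= e * (`|s - s0| + `|t - t0|)) ->
  circulation U W a b c d = 0.
Proof.
move=> ab cd dU dW dPQ; apply/eqP; apply: contraT => C0.
set L := (b - a) + (d - c).
(* Halving makes the inequality strict, so that it is inherited by a quarter. *)
pose k := `|circulation U W a b c d| / 2.
have k0 : 0 < k by rewrite /k divr_gt0 ?normr_gt0.
have kC : k < `|circulation U W a b c d|.
  by rewrite /k; have : 0 < `|circulation U W a b c d|; [rewrite normr_gt0|lra].
pose inv (n : nat) (x : R * R * (R * R)) := [/\ a <= x.1.1, x.1.1 <= x.1.2, x.1.2 <= b,
   x.1.2 - x.1.1 = (b - a) / 2 ^+ n & [/\ c <= x.2.1, x.2.1 <= x.2.2, x.2.2 <= d,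
   x.2.2 - x.2.1 = (d - c) / 2 ^+ n &
   k / 4 ^+ n < `|circulation U W x.1.1 x.1.2 x.2.1 x.2.2|]].
have step n x : exists y, inv n x -> inv n.+1 y /\
   [/\ x.1.1 <= y.1.1, y.1.2 <= x.1.2, x.2.1 <= y.2.1 & y.2.2 <= x.2.2].
  have [|ninv] := pselect (inv n x); last by exists x.
  move=> [h1 h2 h3 h4 [h5 h6 h7 h8 h9]].
  have [a' [b' [c' [d' [k1 k2 k3 k4 [k5 k6 k7 k8 k9]]]]]] := bisect_circulation h2 h6 h9.
  exists (a', b', (c', d')) => _; split; last by split.
  split=> /=; [exact: le_trans h1 k1|done|exact: le_trans k3 h3|
    by rewrite k4 h4 exprS invfM [_ / 2 ^+ n]mulrC; ring|].
  split; [exact: le_trans h5 k5|done|exact: le_trans k7 h7|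
    by rewrite k8 h8 exprS invfM; ring|].
  by apply: le_lt_trans k9; rewrite exprS invfM mulrA mulrAC.
have [next nextP] := choice (fun nx : nat * (R * R * (R * R)) => step nx.1 nx.2).
pose X := fix X n := if n is m.+1 then next (m, X m) else (a, b, (c, d)).
have Xinv n : inv n (X n).
  elim: n => [|n IH]; first by split; rewrite /= ?expr0 ?divr1 ?lexx ?ab //;
    split; rewrite /= ?expr0 ?divr1 ?lexx ?cd.
  by have [] := nextP (n, X n) IH.
have Xn n : [/\ (X n).1.1 <= (X n.+1).1.1, (X n.+1).1.2 <= (X n).1.2,
     (X n).2.1 <= (X n.+1).2.1 & (X n.+1).2.2 <= (X n).2.2].
  by have [] := nextP (n, X n) (Xinv n).
have [s0 hs0] : exists x, forall n, (X n).1.1 <= x <= (X n).1.2.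
  apply: nested_intervals => n; [by have [] := Xn n|by have [] := Xn n|by have [] := Xinv n].
have [t0 ht0] : exists x, forall n, (X n).2.1 <= x <= (X n).2.2.
  apply: nested_intervals => n;
      [by have [] := Xn n|by have [] := Xn n|by have [_ _ _ _ []] := Xinv n].
have [p1 [p2 [q2 h]]] := dPQ s0 t0 (hs0 0%N) (ht0 0%N).
have L0 : 0 <= L by rewrite /L; lra.
(* [L + 1] instead of [L] keeps the denominator positive for a degenerate
   rectangle and the final comparison strict. *)
pose e := k / (2 * (L + 1) ^+ 2).
have L1 : 0 < (L + 1) ^+ 2 by rewrite exprn_gt0//; lra.
have e0 : 0 < e by rewrite /e divr_gt0// mulr_gt0.
have [r r0 {}h] := h e e0.
have [n Ln] : exists n, L / 2 ^+ n < r.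
  have [n nb] : exists n : nat, L / r < n%:R.
    by exists (Num.bound (L / r)); apply: archi_boundP; rewrite divr_ge0// ltW.
  exists n; rewrite ltr_pdivrMr ?exprn_gt0//.
  move: nb; rewrite ltr_pdivrMr// => /lt_le_trans; apply.
  rewrite mulrC ler_wpM2l ?(ltW r0)// -natrX ler_nat.
  exact/ltnW/ltn_expl.
have [i1 i2 i3 i4 [i5 i6 i7 i8 i9]] := Xinv n.
have /= := hs0 n; have /= := ht0 n.
set a' := (X n).1.1 in i1 i2 i3 i4 i5 i6 i7 i8 i9 *.
set b' := (X n).1.2 in i1 i2 i3 i4 i5 i6 i7 i8 i9 *.
set c' := (X n).2.1 in i1 i2 i3 i4 i5 i6 i7 i8 i9 *.
set d' := (X n).2.2 in i1 i2 i3 i4 i5 i6 i7 i8 i9 *.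
move=> tc sa.
have close s t : a' <= s <= b' -> c' <= t <= d' -> `|s - s0| + `|t - t0| < r.
  move=> hs ht; apply: le_lt_trans Ln.
  have -> : L / 2 ^+ n = (b' - a') + (d' - c') by rewrite i4 i8 /L; ring.
  by apply: lerD; rewrite ler_norml; lra.
have wa s : a' <= s <= b' -> a <= s <= b.
  by move=> /andP[h1 h2]; rewrite (le_trans i1 h1) (le_trans h2 i3).
have wc t : c' <= t <= d' -> c <= t <= d.
  by move=> /andP[h1 h2]; rewrite (le_trans i5 h1) (le_trans h2 i7).
have := @circulation_small R P Q U W a' b' c' d' s0 t0 p1 p2 q2 e sa tc (ltW e0)
  (fun s t hs ht => dU s t (wa s hs) (wc t ht))
  (fun s t hs ht => dW s t (wa s hs) (wc t ht))
  (fun s t hs ht => proj1 (h s t (close s t hs ht)))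
  (fun s t hs ht => proj2 (h s t (close s t hs ht))).
move=> /(lt_le_trans i9).
have -> : b' - a' + (d' - c') = L / 2 ^+ n by rewrite i4 i8 /L; ring.
have -> : 2 * e * (L / 2 ^+ n) ^+ 2 = (k / 4 ^+ n) * (L ^+ 2 / (L + 1) ^+ 2).
  have -> : (4 : R) ^+ n = (2 ^+ n) ^+ 2 by rewrite -exprM mulnC exprM; congr (_ ^+ n); ring.
  rewrite /e; field; rewrite expf_neq0//=; apply/andP; split=> //; apply/eqP => LE; lra.
have k4 : 0 < k / 4 ^+ n by rewrite divr_gt0 ?exprn_gt0.
rewrite ltr_pMr// ltr_pdivlMr// mul1r => hh; exfalso; nra.
Qed.

Import Normc.
Local Open Scope complex_scope.
Local Open Scope ring_scope.

(** * Complex differentiability *)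

(** For a complex field this is complex differentiability, and for a real field
    the usual one; the real case serves the one-variable slices of a complex
    function. *)
Definition cdiff (C : numFieldType) (h : C -> C) (z : C) : Prop := derivable h z 1.

Lemma derive_cvg_epsP (C : numFieldType) (h : C -> C) (z d : C) :
  (fun k : C => k^-1 *: ((h \o shift z) (k *: 1) - h z)) @ 0^' --> d <->
  forall e : C, 0 < e -> exists2 r : C, 0 < r &
    forall k, `|k| < r -> `|h (z + k) - h z - d * k| <= e * `|k|.
Proof.
split.
  move=> /cvgrPdist_le hd e e0.
  have := hd _ e0; rewrite near_withinE => /nbhs_ballP[r /= r0 hr].
  exists r => // k kr; have [->|k0] := eqVneq k 0.
    by rewrite addr0 subrr mulr0 subrr normr0 mulr0.
  have := hr k; rewrite /ball /= sub0r normrN => /(_ kr k0).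
  rewrite /GRing.scale /= mulr1 [k + z]addrC => hh.
  rewrite -ler_pdivrMr ?normr_gt0//.
  rewrite -normfV -normrM; apply: le_trans hh.
  by rewrite -normrN le_eqVlt; apply/orP; left; apply/eqP; congr `|_|; field.
move=> hd; apply/cvgrPdist_le => e e0.
have [r r0 hr] := hd e e0.
rewrite near_withinE; apply/nbhs_ballP; exists r => //=.
move=> k; rewrite /ball /= sub0r normrN => kr k0.
rewrite /GRing.scale /= mulr1 [k + z]addrC.
have := hr k kr; rewrite -ler_pdivrMr ?normr_gt0//.
rewrite -normfV -normrM; apply: le_trans.
by rewrite -normrN le_eqVlt; apply/orP; left; apply/eqP; congr `|_|; field.
Qed.

Lemma cdiffP (C : numFieldType) (h : C -> C) (z : C) :
  cdiff h z <->
  exists d : C, forall e : C, 0 < e -> exists2 r : C, 0 < r &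
    forall k, `|k| < r -> `|h (z + k) - h z - d * k| <= e * `|k|.
Proof.
split=> [/cvg_ex[d /derive_cvg_epsP hd]|[d /derive_cvg_epsP hd]]; first by exists d.
by apply/cvg_ex; exists d.
Qed.

Lemma is_derive_eps (C : numFieldType) (h : C -> C) (z d : C) :
  is_derive z 1 h d -> forall e : C, 0 < e -> exists2 r : C, 0 < r &
    forall k, `|k| < r -> `|h (z + k) - h z - d * k| <= e * `|k|.
Proof. by move=> [dh <-]; apply/derive_cvg_epsP. Qed.

Lemma cdiff_normcP (R : realType) (h : R[i] -> R[i]) (z : R[i]) :
  cdiff h z <->
  exists d : R[i], forall e : R, 0 < e -> exists2 r : R, 0 < r &
    forall k, normc k < r -> normc (h (z + k) - h z - d * k) <= e * normc k.
Proof.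
split=> [/cdiffP[d hd]|[d hd]].
  exists d => e e0.
  have [|r r0 hr] := hd e%:C; first by rewrite ltcR.
  have rE : r = (complex.Re r)%:C by rewrite RRe_real// ger0_real// ltW.
  exists (complex.Re r); first by rewrite -ltcR -rE.
  move=> k kr; rewrite -lecR rmorphM /=; apply: hr.
  by rewrite rE ltcR.
apply/cdiffP; exists d => e e0.
have eE : e = (complex.Re e)%:C by rewrite RRe_real// ger0_real// ltW.
have [|r r0 hr] := hd (complex.Re e); first by rewrite -ltcR -eE.
exists r%:C; first by rewrite ltcR.
move=> k; rewrite ltcR => /hr; rewrite -lecR rmorphM /= -eE; exact.
Qed.

Section cdiff_theory.
Variable C : numFieldType.
Implicit Types (f g : C -> C) (z : C).

Lemma cdiff_cst (c z : C) : cdiff (fun=> c) z.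
Proof. exact: derivable_cst. Qed.
Lemma cdiff_id z : cdiff id z.
Proof. exact: derivable_id. Qed.
Lemma cdiffD f g z : cdiff f z -> cdiff g z -> cdiff (fun w => f w + g w) z.
Proof. exact: derivableD. Qed.
Lemma cdiffB f g z : cdiff f z -> cdiff g z -> cdiff (fun w => f w - g w) z.
Proof. exact: derivableB. Qed.
Lemma cdiffM f g z : cdiff f z -> cdiff g z -> cdiff (fun w => f w * g w) z.
Proof. exact: derivableM. Qed.
Lemma cdiffV f z : f z != 0 -> cdiff f z -> cdiff (fun w => (f w)^-1) z.
Proof. exact: derivableV. Qed.
Lemma cdiffX f n z : cdiff f z -> cdiff (fun w => f w ^+ n) z.
Proof.
move=> df; elim: n => [|n IH].
  by under eq_fun do rewrite expr0; exact: cdiff_cst.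
by under eq_fun do rewrite exprS; exact: cdiffM.
Qed.
Lemma cdiff_sum (I : finType) (f : I -> C -> C) z :
  (forall i, cdiff (f i) z) -> cdiff (fun w => \sum_i f i w) z.
Proof.
move=> df; elim: (index_enum I) => [|i s IH].
  by under eq_fun do rewrite big_nil; exact: cdiff_cst.
by under eq_fun do rewrite big_cons; exact: cdiffD.
Qed.
Lemma cdiff_prod (T : Type) (s : seq T) (f : T -> C -> C) z :
  (forall i, cdiff (f i) z) -> cdiff (fun w => \prod_(i <- s) f i w) z.
Proof.
move=> df; elim: s => [|i s IH].
  by under eq_fun do rewrite big_nil; exact: cdiff_cst.
by under eq_fun do rewrite big_cons; exact: cdiffM.
Qed.

Lemma cdiff_lipschitz f z : cdiff f z -> exists K r : C, [/\ 0 < K, 0 < r &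
  forall k, `|k| < r -> `|f (z + k) - f z| <= K * `|k|].
Proof.
move=> /cdiffP[d /(_ 1 ltr01)[r r0 hr]]; exists (1 + `|d|), r; split=> //.
move=> k /hr hk; rewrite mul1r in hk; rewrite mulrDl mul1r -normrM.
by rewrite -[X in `|X|](subrK (d * k)); apply: le_trans (ler_normD _ _) (lerD hk _).
Qed.

Lemma cdiff_comp f g z : cdiff f z -> cdiff g (f z) -> cdiff (fun w => g (f w)) z.
Proof.
move=> df /cdiffP[d' hg]; have [K [r1 [K0 r10 fK]]] := cdiff_lipschitz df.
move/cdiffP: df => [d hf].
apply/cdiffP; exists (d' * d) => e e0.
pose e1 := e / 2 / K; pose e2 := e / 2 / (1 + `|d'|).
have e10 : 0 < e1 by rewrite !divr_gt0.
have d0 : 0 < 1 + `|d'| by rewrite ltr_pwDl.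
have e20 : 0 < e2 by rewrite !divr_gt0.
have [r2 r20 hr2] := hg e1 e10; have [r3 r30 hr3] := hf e2 e20.
have [r r0 [rr1 rr2 rr3]] : exists2 r : C, 0 < r & [/\ r <= r1, K * r <= r2 & r <= r3].
  pose s := r2 / K.
  have s0 : 0 < s by rewrite divr_gt0.
  exists (1 / (1 / r1 + 1 / s + 1 / r3)).
    by rewrite divr_gt0 ?addr_gt0 ?divr_gt0.
  have inv_le (t u : C) : 0 < t -> 1 / t <= u -> 1 / u <= t.
    move=> t0 tu; have u0 : 0 < u by apply: lt_le_trans tu; rewrite divr_gt0.
    by rewrite !div1r in tu *; rewrite -[t]invrK lef_pV2 ?posrE ?invr_gt0.
  have p1 : 0 <= 1 / r1 by rewrite divr_ge0// ltW.
  have p2 : 0 <= 1 / s by rewrite divr_ge0// ltW.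
  have p3 : 0 <= 1 / r3 by rewrite divr_ge0// ltW.
  split.
  - by apply: inv_le => //; rewrite -addrA lerDl addr_ge0.
  - rewrite mulrC -ler_pdivlMr//; apply: inv_le => //.
    by rewrite addrAC lerDr addr_ge0.
  - by apply: inv_le => //; rewrite lerDr addr_ge0.
exists r => // k kr.
have kr1 := lt_le_trans kr rr1.
have fk := fK k kr1.
have l2 : `|f (z + k) - f z| < r2.
  by apply: le_lt_trans fk _; apply: lt_le_trans rr2; rewrite ltr_pM2l.
have := hr2 _ l2; rewrite [f z + _]addrC subrK => h1.
have h2 := hr3 k (lt_le_trans kr rr3).
have -> : g (f (z + k)) - g (f z) - d' * d * k =
  (g (f (z + k)) - g (f z) - d' * (f (z + k) - f z)) + d' * (f (z + k) - f z - d * k) by ring.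
apply: le_trans (ler_normD _ _) _.
rewrite (_ : e * `|k| = e1 * (K * `|k|) + (1 + `|d'|) * (e2 * `|k|)); last first.
  rewrite /e1 /e2; field; rewrite !gt_eqF//.
apply: lerD.
  by apply: le_trans h1 _; rewrite ler_wpM2l// ltW.
rewrite normrM; apply: ler_pM => //.
by rewrite lerDr.
Qed.

(** The derivative is 0. This is how a double zero cancels a bounded
    singularity. *)
Lemma cdiff_of_quadratic_bound f z (K r : C) : 0 < r -> 0 < K -> f z = 0 ->
  (forall w, `|w - z| < r -> `|f w| <= K * `|w - z| ^+ 2) -> cdiff f z.
Proof.
move=> r0 K0 fz fK; apply/cdiffP; exists 0 => e e0.
have [s s0 [sr se]] : exists2 s : C, 0 < s & [/\ s <= r & s <= e / K].
  have eK : 0 < e / K by rewrite divr_gt0.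
  have [h|h] := boolP (r <= e / K); first by exists r.
  have := real_leVge (gtr0_real r0) (gtr0_real eK); rewrite (negbTE h) /= => h'.
  by exists (e / K).
exists s => // k ks; rewrite fz subr0 mul0r subr0.
have := fK (z + k); rewrite [z + k]addrC addrK => /(_ (lt_le_trans ks sr)) h.
apply: le_trans h _; rewrite expr2 mulrA ler_wpM2r//.
by rewrite mulrC -ler_pdivlMr// ltW// (lt_le_trans ks).
Qed.
End cdiff_theory.

Lemma cdiff_real_continuous (R : realType) (g : R -> R) (x : R) :
  cdiff g x -> {for x, continuous g}.
Proof. by move=> /derivable1_diffP; exact: differentiable_continuous. Qed.

Lemma cdiffE (C : numFieldType) (h : C -> C) (z : C) : cdiff h z = derivable h z 1.
Proof. by []. Qed.

Opaque cdiff.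

(** * The complex exponential and mean values on circles *)

Section cexp.
Variable R : realType.
Implicit Types z w : R[i].

Definition cexp z : R[i] :=
  (expR (complex.Re z) * cos (complex.Im z)) +i* (expR (complex.Re z) * sin (complex.Im z)).

Lemma cexpD z w : cexp (z + w) = cexp z * cexp w.
Proof.
case: z w => [a b] [c d]; rewrite /cexp /= expRD sinD cosD; simpc.
by congr (_ +i* _); ring.
Qed.

Lemma normc_cexp z : normc (cexp z) = expR (complex.Re z).
Proof.
rewrite /cexp /= !exprMn -mulrDr cos2Dsin2 mulr1 sqrtr_sqr ger0_norm//.
Qed.

Lemma normc_le_ReIm z : normc z <= `|complex.Re z| + `|complex.Im z|.
Proof.
have -> : z = (complex.Re z)%:C + (0 +i* complex.Im z) by case: z => a b; simpc.
apply: le_trans (le_normcD _ _) _; simpc => /=.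
by rewrite expr0n /= addr0 add0r !sqrtr_sqr.
Qed.

Lemma Re_le_normc z : `|complex.Re z| <= normc z.
Proof. by rewrite -lecR; exact: normc_ge_Re. Qed.

Lemma Im_le_normc z : `|complex.Im z| <= normc z.
Proof.
case: z => a b /=; rewrite -sqrtr_sqr ler_sqrt ?lerDr ?sqr_ge0//.
by rewrite addr_ge0 ?sqr_ge0.
Qed.

Lemma cdiff_cexp0 : cdiff cexp (0 : R[i]).
Proof.
apply/cdiff_normcP; exists 1 => e e0.
pose e1 := e / (10 + e).
have e10 : 0 < e1 by rewrite divr_gt0 ?addr_gt0.
have e11 : e1 <= 1 by rewrite ler_pdivrMr ?addr_gt0//; lra.
have e1e : 10 * e1 <= e.
  rewrite /e1 mulrA ler_pdivrMr ?addr_gt0//; nra.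
move: e1 e10 e11 e1e => e1 e10 e11 e1e.
have [r1 r10 h1] := is_derive_eps (is_derive_expR (0 : R)) e10.
have [r2 r20 h2] := is_derive_eps (is_derive_sin (0 : R)) e10.
have [r3 r30 h3] := is_derive_eps (is_derive_cos (0 : R)) e10.
pose r := Num.min (e1 / 2) (Num.min r1 (Num.min r2 r3)).
have r0 : 0 < r by rewrite /r !lt_min divr_gt0 ?r10 ?r20 ?r30.
exists r => // k kr.
have sk := Re_le_normc k; have tk := Im_le_normc k.
move: kr; rewrite /r !lt_min => /and4P[kr0 kr1 kr2 kr3].
set s := complex.Re k in sk *; set t := complex.Im k in tk *.
have := h1 s (le_lt_trans sk kr1); rewrite add0r expR0 [1 * s]mul1r => {}h1.
have := h2 t (le_lt_trans tk kr2); rewrite add0r sin0 cos0 [1 * t]mul1r subr0 => {}h2.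
have := h3 t (le_lt_trans tk kr3); rewrite add0r sin0 cos0 oppr0 mul0r subr0 => {}h3.
rewrite ?add0r mul1r; apply: le_trans (normc_le_ReIm _) _.
have -> : cexp k - cexp 0 - k = (expR s * (cos t - 1) + (expR s - 1 - s)) +i*
   (expR s * (sin t - t) + (expR s - 1) * t).
  have -> : k = s +i* t by rewrite /s /t; case: (k).
  rewrite /cexp /= expR0 cos0 sin0 mulr0 mulr1; simpc.
  by congr (_ +i* _); ring.
rewrite /=.
have E1 : `|expR s - 1| <= e1.
  have -> : expR s - 1 = (expR s - 1 - s) + s by ring.
  apply: le_trans (ler_normD _ _) _; have : e1 * `|s| <= 1 * `|s| by rewrite ler_wpM2r.
  lra.
have E2 : `|expR s| <= 2.
  have -> : expR s = (expR s - 1) + 1 by ring.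
  apply: le_trans (ler_normD _ _) _; rewrite normr1; lra.
have n0 : 0 <= normc k by apply: le_trans sk.
have F1 : `|expR s * (cos t - 1)| <= 2 * (e1 * normc k).
  rewrite normrM; apply: ler_pM => //; apply: le_trans h3 _; rewrite ler_wpM2l// ltW//.
have F2 : `|expR s * (sin t - t)| <= 2 * (e1 * normc k).
  rewrite normrM; apply: ler_pM => //; apply: le_trans h2 _; rewrite ler_wpM2l// ltW//.
have F3 : `|expR s - 1 - s| <= e1 * normc k.
  apply: le_trans h1 _; rewrite ler_wpM2l// ltW//.
have F4 : `|(expR s - 1) * t| <= e1 * normc k by rewrite normrM ler_pM.
have G1 := ler_normD (expR s * (cos t - 1)) (expR s - 1 - s).
have G2 := ler_normD (expR s * (sin t - t)) ((expR s - 1) * t).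
have : 10 * e1 * normc k <= e * normc k by rewrite ler_wpM2r.
have : 0 <= e1 * normc k by rewrite mulr_ge0// ltW.
nra.
Qed.

Lemma cdiff_cexp z : cdiff cexp z.
Proof.
have -> : cexp = fun w => cexp z * cexp (w - z).
  by apply/funext => w; rewrite -cexpD [z + _]addrC subrK.
apply: cdiffM; first exact: cdiff_cst.
apply: (@cdiff_comp _ (fun w => w - z) cexp).
  by apply: cdiffB; [exact: cdiff_id|exact: cdiff_cst].
by rewrite subrr; exact: cdiff_cexp0.
Qed.

End cexp.

(** The Cauchy-Riemann equations: the coefficient of [t] in the imaginary part is
    that of [s] in the real part, which says that [Im F ds + Re F dt] is closed. *)
Lemma cdiff_ReIm_expansion (R : realType) (F : R[i] -> R[i]) (s0 t0 : R) :
  cdiff F (s0 +i* t0) -> exists a b : R, forall e : R, 0 < e -> exists2 r : R, 0 < r &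
    forall s t, `|s - s0| + `|t - t0| < r ->
    `|complex.Im (F (s +i* t)) - complex.Im (F (s0 +i* t0)) - b * (s - s0) - a * (t - t0)|
       <= e * (`|s - s0| + `|t - t0|) /\
    `|complex.Re (F (s +i* t)) - complex.Re (F (s0 +i* t0)) - a * (s - s0) - (- b) * (t - t0)|
       <= e * (`|s - s0| + `|t - t0|).
Proof.
move=> /cdiff_normcP[[a b] hd]; exists a, b => e e0.
have [r r0 hr] := hd e e0; exists r => // s t str.
have kst := normc_le_ReIm ((s - s0) +i* (t - t0)).
have := hr _ (le_lt_trans kst str); rewrite /= in kst.
have -> : (s0 +i* t0 + (s - s0) +i* (t - t0)) = s +i* t.
  by simpc; congr (_ +i* _); ring.
set D := F _ - _ - _ => hD.
have eD : e * normc ((s - s0) +i* (t - t0)) <= e * (`|s - s0| + `|t - t0|).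
  by rewrite ler_wpM2l// ltW.
split.
  have -> : complex.Im (F (s +i* t)) - complex.Im (F (s0 +i* t0)) - b * (s - s0) - a * (t - t0) =
      complex.Im D.
    by rewrite /D; case: (F (s +i* t)) => x y; case: (F (s0 +i* t0)) => x' y' /=; ring.
  by apply: le_trans (Im_le_normc _) _; exact: le_trans hD eD.
have -> : complex.Re (F (s +i* t)) - complex.Re (F (s0 +i* t0)) - a * (s - s0) - (- b) * (t - t0)
    = complex.Re D.
  by rewrite /D; case: (F (s +i* t)) => x y; case: (F (s0 +i* t0)) => x' y' /=; ring.
by apply: le_trans (Re_le_normc _) _; exact: le_trans hD eD.
Qed.

(** With [F = h \o cexp], the integral [J s] of [Re F] over a period is constant
    in [s], since the two horizontal sides of the rectangle cancel by
    periodicity. By the mean value theorem, [J s] is [2 pi] times a value of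
    [Re h] on the circle of radius [e^s]; comparing a given circle with
    arbitrarily small ones identifies this value as [Re (h 0)]. *)
Lemma Re_mean_value (R : realType) (h : R[i] -> R[i]) (r : R) :
  (forall z, normc z < 1 -> cdiff h z) -> 0 < r -> r < 1 ->
  exists2 z, normc z = r & complex.Re (h z) = complex.Re (h 0).
Proof.
move=> dh r0 r1.
pose F z := h (cexp z).
have dF (s t : R) : s < 0 -> cdiff F (s +i* t).
  move=> s0; apply: cdiff_comp; first exact: cdiff_cexp.
  by apply: dh; rewrite normc_cexp expR_lt1.
pose P s t := complex.Im (F (s +i* t)).
pose Q s t := complex.Re (F (s +i* t)).
have Pc (s t : R) : s < 0 -> {for s, continuous (fun s => P s t)}.
  move=> s0; have [a [b hab]] := cdiff_ReIm_expansion (dF s t s0).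
  apply/cdiff_real_continuous/cdiffP; exists b => e /hab[d d0 hd]; exists d => // k kd.
  have := hd (s + k) t; rewrite subrr normr0 addr0 mulr0 subr0 [s + k - s]addrC addKr.
  by move=> /(_ kd)[].
have Qc (s t : R) : s < 0 -> {for t, continuous (Q s)}.
  move=> s0; have [a [b hab]] := cdiff_ReIm_expansion (dF s t s0).
  apply/cdiff_real_continuous/cdiffP; exists (- b) => e /hab[d d0 hd]; exists d => // k kd.
  have := hd s (t + k); rewrite subrr normr0 add0r !mulr0 !subr0 [t + k - t]addrC addKr.
  by move=> /(_ kd)[].
pose tp : R := pi *+ 2.
have tp0 : 0 < tp by rewrite pmulrn_lgt0 ?pi_gt0.
have [V hV] := antiderivative_operator tp0.
pose W s := V (Q s).
have dW (s t : R) : s < 0 -> 0 <= t <= tp -> is_derive t 1 (W s) (Q s t).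
  by move=> s0 ht; apply: hV => // x _; exact: Qc.
have JQ (s : R) : s < 0 -> exists xi, W s tp - W s 0 = Q s xi * tp.
  move=> s0; have [| |xi _ E] := @MVT_segment _ (W s) (Q s) 0 tp (ltW tp0).
  - by move=> x; rewrite in_itv /= => /andP[/ltW x0 /ltW xt]; apply: dW; rewrite ?x0.
  - apply: derivable_within_continuous => x; rewrite in_itv /= => xtp.
    by have [] := dW s x s0 xtp.
  by exists xi; rewrite E subr0.
have JJ (s1 s2 : R) : s1 < s2 -> s2 < 0 -> W s1 tp - W s1 0 = W s2 tp - W s2 0.
  move=> s12 s20.
  have [G hG] := antiderivative_operator s12.
  pose U t := G (fun s => P s t).
  (* The slices at both ends of the period are the same function. *)
  have U0 : U tp = U 0.
    congr G; apply/funext => s; rewrite /P /F /cexp /=.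
    by rewrite cos2pi sin2pi cos0 sin0.
  have := @circulation_closed_form R P Q U W s1 s2 0 tp (ltW s12) (ltW tp0).
  rewrite /circulation U0 subrr add0r => C0.
  apply/esym/eqP; rewrite -subr_eq0; apply/eqP; apply: C0.
  - move=> s t /andP[h1 h2] _; apply: (hG (fun s => P s t)); last by rewrite h1.
    by move=> x /andP[_ hx]; apply: Pc; exact: le_lt_trans hx s20.
  - by move=> s t /andP[_ h2]; apply: dW; exact: le_lt_trans h2 s20.
  - move=> s t /andP[_ h2] _.
    have [a [b hab]] := cdiff_ReIm_expansion (dF s t (le_lt_trans h2 s20)).
    by exists b, a, (- b).
have lr0 : ln r < 0 by rewrite ln_lt0// r0.
have [xi2 E2] := JQ _ lr0.
exists (cexp (ln r +i* xi2)); first by rewrite normc_cexp /= lnK.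
apply/eqP; apply: contraT; rewrite -subr_eq0 => neq.
have [d [d' hd]] : exists d d' : R, [/\ 0 < d, 0 < d' &
    forall k, normc k < d -> normc (h k - h 0) <= d' * normc k].
  have /cdiff_lipschitz[K [d [K0 d0 hK]]] : cdiff h (0 : R[i]) by apply: dh; rewrite normc0.
  exists (complex.Re d), (complex.Re K).
  have dE : d = (complex.Re d)%:C by rewrite RRe_real// ger0_real// ltW.
  have KE : K = (complex.Re K)%:C by rewrite RRe_real// ger0_real// ltW.
  split; rewrite -?ltcR -?dE -?KE // => k.
  rewrite -ltcR -dE => /hK; rewrite add0r => hk.
  by rewrite -lecR rmorphM /= -KE.
move: hd => [d0 d0' hd].
set eta := `|complex.Re (h (cexp (ln r +i* xi2))) - complex.Re (h 0)|.
have eta0 : 0 < eta by rewrite normr_gt0.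
pose rho := Num.min (Num.min (r / 2) (d / 2)) (eta / d' / 2).
have rho0 : 0 < rho by rewrite /rho !lt_min !divr_gt0.
have [rr rd re] : [/\ rho < r, rho < d & d' * rho < eta].
  rewrite /rho; split; rewrite ?gt_min.
  - by rewrite (_ : r / 2 < r) //; lra.
  - by rewrite (_ : d / 2 < d) ?orbT //; lra.
  - rewrite mulrC -ltr_pdivlMr// gt_min; apply/orP; right.
    have : 0 < eta / d' by rewrite divr_gt0.
    lra.
have lrho : ln rho < ln r by rewrite ltr_ln.
have [xi1 E1] := JQ _ (lt_trans lrho lr0).
have EQ : Q (ln rho) xi1 = Q (ln r) xi2.
  by apply: (mulIf (lt0r_neq0 tp0)); rewrite -E1 -E2 (JJ _ _ lrho lr0).
have nrho : normc (cexp (ln rho +i* xi1)) = rho by rewrite normc_cexp /= lnK.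
have := hd (cexp (ln rho +i* xi1)); rewrite nrho => /(_ rd) /le_lt_trans /(_ re).
move=> /(le_lt_trans (Re_le_normc _)).
rewrite raddfB /= -/(F _) -/(Q _ _) EQ /Q /F.
by rewrite ltxx.
Qed.

(** Multiplying [h] by [(h 0)^*], which makes its value at 0 nonnegative, reduces
    the claim to the mean value property of the real part. *)
Lemma circle_max (R : realType) (h : R[i] -> R[i]) (r : R) :
  (forall z : R[i], `|z| < 1 -> cdiff h z) -> 0 < r -> r < 1 ->
  exists2 z : R[i], `|z| = r%:C & `|h 0| <= `|h z|.
Proof.
move=> dh r0 r1.
have [h00|h00] := eqVneq (h 0) 0.
  by exists r%:C; [rewrite ger0_norm// lecR ltW|rewrite h00 normr0].
have [|z zr E] := @Re_mean_value R (fun w => (h 0)^* * h w) r _ r0 r1.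
  move=> z z1; apply: cdiffM; first exact: cdiff_cst.
  by apply: dh; rewrite ltcR.
exists z; first by rewrite -zr.
have n0 : 0 < `|h 0| by rewrite normr_gt0.
rewrite -(ler_pM2l n0) -expr2 normCK mulrC.
have r_ : (h 0)^* * h 0 \is Num.real by rewrite mulrC -normCK ger0_real// exprn_ge0.
rewrite -(RRe_real r_) -E -[in leRHS](norm_conjC (h 0)) -normrM lecR.
by apply: le_trans (ler_norm _) (Re_le_normc _).
Qed.

(** * Blaschke factors and removable punctures *)

Section mobius.
Variable C : numClosedFieldType.
Implicit Types a z w : C.

Definition blaschke a z : C := (z - a) / (1 - a^* * z).

Lemma disc_denom_lower a z : `|a| < 1 -> `|z| < 1 -> 1 - `|a| <= `|1 - a^* * z|.
Proof.
move=> a1 z1; have := ler_dist_dist 1 (a^* * z).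
rewrite normr1 normrM norm_conjC => h.
have az : `|a| * `|z| <= `|a| by rewrite ler_piMr// ltW.
have {h}: 1 - `|a| * `|z| <= `|1 - a^* * z|.
  apply: le_trans h; apply: real_ler_norm; rewrite realB// realM//.
by apply: le_trans; rewrite lerD2l lerN2.
Qed.

Lemma disc_denom_neq0 a z : `|a| < 1 -> `|z| < 1 -> 1 - a^* * z != 0.
Proof.
move=> a1 z1; rewrite -normr_gt0; apply: lt_le_trans (disc_denom_lower a1 z1).
by rewrite subr_gt0.
Qed.

Lemma blaschke_kernel a z w : 1 - a^* * z != 0 -> 1 - a^* * w != 0 ->
  1 - (blaschke a z)^* * blaschke a w =
  (1 - a^* * a) * (1 - z^* * w) / ((1 - a^* * z)^* * (1 - a^* * w)).
Proof.
move=> hz hw; have hz' : 1 - a * z^* != 0.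
  by move: hz; rewrite -conjC_eq0 rmorphB rmorphM rmorph1 /= conjCK.
rewrite /blaschke !rmorphM !fmorphV !rmorphB !rmorphM rmorph1 /= conjCK.
by field; rewrite hw hz'.
Qed.

Lemma blaschke_defect a z : `|a| < 1 -> `|z| < 1 ->
  1 - `|blaschke a z| ^+ 2 = (1 - `|a| ^+ 2) * (1 - `|z| ^+ 2) / `|1 - a^* * z| ^+ 2.
Proof.
move=> a1 z1; have hz := disc_denom_neq0 a1 z1.
by rewrite !normCK mulrC blaschke_kernel// [z * _]mulrC [a * _]mulrC [(1 - _) * (1 - _)^*]mulrC.
Qed.

Lemma blaschke_lt1 a z : `|a| < 1 -> `|z| < 1 -> `|blaschke a z| < 1.
Proof.
move=> a1 z1; rewrite -(expr_lt1 (n := 2))// -subr_gt0 blaschke_defect//.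
have hz := disc_denom_neq0 a1 z1.
by rewrite divr_gt0 ?mulr_gt0 ?subr_gt0 ?expr_lt1 ?exprn_gt0 ?normr_gt0.
Qed.

(** Uniform convergence of [`|blaschke a z|] to 1 at the unit circle. *)
Lemma blaschke_defect_le a z : `|a| < 1 -> `|z| < 1 ->
  1 - `|blaschke a z| ^+ 2 <= (1 - `|a|) ^- 2 * (1 - `|z| ^+ 2).
Proof.
move=> a1 z1; rewrite blaschke_defect// mulrC; apply: ler_pM.
- by rewrite invr_ge0 exprn_ge0.
- by rewrite mulr_ge0// subr_ge0 expr_le1// ltW.
- have d0 : 0 < 1 - `|a| by rewrite subr_gt0.
  have dl := disc_denom_lower a1 z1.
  rewrite lef_pV2 ?posrE ?exprn_gt0// ?(lt_le_trans d0)//.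
  by rewrite ler_pXn2r// nnegrE ltW.
- apply: ler_piMl; first by rewrite subr_ge0 expr_le1// ltW.
  by rewrite gerBl exprn_ge0.
Qed.

Lemma blaschke_eq0 a z : `|a| < 1 -> `|z| < 1 -> (blaschke a z == 0) = (z == a).
Proof.
move=> a1 z1; rewrite mulf_eq0 invr_eq0 (negbTE (disc_denom_neq0 a1 z1)) orbF.
by rewrite subr_eq0.
Qed.

Lemma cdiff_blaschke a z : `|a| < 1 -> `|z| < 1 -> cdiff (blaschke a) z.
Proof.
move=> a1 z1; apply: cdiffM.
  by apply: cdiffB; [exact: cdiff_id|exact: cdiff_cst].
apply: (@cdiffV _ (fun w => 1 - a^* * w)); first exact: disc_denom_neq0.
apply: cdiffB; first exact: cdiff_cst.
by apply: cdiffM; [exact: cdiff_cst|exact: cdiff_id].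
Qed.

Lemma pos_common_lower_bound (r1 r2 : C) : 0 < r1 -> 0 < r2 ->
  exists2 r : C, 0 < r & (r <= r1) /\ (r <= r2).
Proof.
move=> r10 r20; have [h|h] := boolP (r1 <= r2); first by exists r1.
exists r2 => //; split=> //; have := real_leVge (gtr0_real r10) (gtr0_real r20).
by rewrite (negbTE h).
Qed.

Lemma cdiff_locally_bounded (f : C -> C) z : cdiff f z -> exists K r : C,
  [/\ 0 < K, 0 < r & forall w, `|w - z| < r -> `|f w| <= K].
Proof.
move=> /cdiff_lipschitz[K [r [K0 r0 hK]]].
exists (K * r + `|f z|), r; split=> //; first by rewrite ltr_wpDr// mulr_gt0.
move=> w wr; rewrite -[f w](subrK (f z)); apply: le_trans (ler_normD _ _) _.
rewrite lerD2r; have := hK (w - z) wr; rewrite [z + _]addrC subrK => /le_trans; apply.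
by rewrite ler_pM2l// ltW.
Qed.

(** The zeros are double so that multiplying by [zeros2 F] turns a bounded
    singularity at a point of [F] into a point of differentiability. *)
Definition zeros2 (F : seq C) z : C := \prod_(p <- F) (z - p) ^+ 2.

Lemma cdiff_zeros2 F z : cdiff (zeros2 F) z.
Proof.
apply: cdiff_prod => p; apply: (@cdiffX _ (fun w => w - p)).
by apply: cdiffB; [exact: cdiff_id|exact: cdiff_cst].
Qed.

Lemma zeros2_eq0 F z : (zeros2 F z == 0) = (z \in F).
Proof.
rewrite /zeros2 prodf_seq_eq0; apply/hasP/idP => [[p pF]|zF].
  by rewrite /= expf_eq0 /= subr_eq0 => /eqP ->.
by exists z; rewrite //= subrr expr0n.
Qed.

(** At a point of [F] the product is bounded by a multiple of the squared
    distance. The value of [g] there is irrelevant, as it is multiplied by 0. *)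
Lemma cdiff_fill_punctures (g : C -> C) (F : seq C) z :
  (z \notin F -> cdiff g z) ->
  (z \in F -> exists K r : C, [/\ 0 < K, 0 < r &
     forall w, `|w - z| < r -> w \notin F -> `|g w| <= K]) ->
  cdiff (fun w => g w * zeros2 F w) z.
Proof.
move=> dg bg; have [zF|zF] := boolP (z \in F); last first.
  by apply: cdiffM; [exact: dg|exact: cdiff_zeros2].
have [K [r [K0 r0 hK]]] := bg zF.
have [K' [r' [K'0 r'0 hK']]] := cdiff_locally_bounded (@cdiff_zeros2 (rem z F) z).
have [s s0 [sr sr']] := pos_common_lower_bound r0 r'0.
apply: (@cdiff_of_quadratic_bound _ _ z (K * K') s) => //; first by rewrite mulr_gt0.
  by apply/eqP; rewrite mulf_eq0 zeros2_eq0 zF orbT.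
move=> w ws; have [wF|wF] := boolP (w \in F).
  have /eqP -> : zeros2 F w == 0 by rewrite zeros2_eq0.
  by rewrite mulr0 normr0 mulr_ge0 ?exprn_ge0// ltW// mulr_gt0.
rewrite /zeros2 (big_rem z zF) /= -/(zeros2 _ w) mulrA mulrAC normrM normrX.
rewrite ler_wpM2r ?exprn_ge0// normrM; apply: ler_pM => //.
  by apply: hK => //; exact: lt_le_trans ws sr.
by apply: hK'; exact: lt_le_trans ws sr'.
Qed.
End mobius.

(** * A Schwarz lemma with punctures *)

(** Bernoulli's inequality. *)
Lemma le1_of_bounded_powers (R : realType) (x c K : R) : 0 < c ->
  (forall m : nat, x ^+ m * c <= K) -> x <= 1.
Proof.
move=> c0 hK; rewrite leNgt; apply/negP => x1.
have y0 : 0 < x - 1 by rewrite subr_gt0.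
have bern m : 1 + m%:R * (x - 1) <= x ^+ m.
  elim: m => [|m IH]; first by rewrite mul0r addr0 expr0.
  have hm : 0 <= (m%:R : R) by [].
  rewrite exprS -natr1; apply: le_trans (ler_wpM2l _ IH); last by lra.
  have : 0 <= m%:R * (x - 1) * (x - 1) by rewrite !mulr_ge0// ltW.
  nra.
have K0 : 0 <= K by apply: le_trans (hK 0%N); rewrite expr0 mul1r ltW.
have := archi_boundP (divr_ge0 K0 (ltW (mulr_gt0 c0 y0))).
set m := Num.bound _; rewrite ltr_pdivrMr ?mulr_gt0// => mK.
have := hK m; rewrite leNgt => /negP; apply.
apply: lt_le_trans (_ : (1 + m%:R * (x - 1)) * c <= _); last by rewrite ler_wpM2r// ltW.
by rewrite mulrDl mul1r; apply: lt_trans mK _; rewrite [X in _ < _ + X]mulrAC -mulrA ltrDr.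
Qed.

Lemma zeros2_le (C : numClosedFieldType) (F : seq C) (z : C) : `|z| < 1 ->
  `|zeros2 F z| <= \prod_(p <- F) (1 + `|p|) ^+ 2.
Proof.
move=> z1; rewrite /zeros2 normr_prod; apply: ler_prod => p _.
rewrite normr_ge0 normrX /=; apply: lerXn2r; rewrite ?nnegrE ?addr_ge0//.
by apply: le_trans (ler_normB _ _) _; rewrite lerD2r ltW.
Qed.

(** At [b] both functions vanish, [phi] at least to first order and [blaschke b]
    to exactly first order; at any other point of the disc [blaschke b] is bounded
    away from 0. *)
Lemma schwarz_quotient_bounded (C : numClosedFieldType) (F : seq C) (phi : C -> C) (b p : C) :
  (forall z, `|z| < 1 -> z \notin F -> `|phi z| <= 1) -> cdiff phi b -> phi b = 0 ->
  `|b| < 1 -> `|p| < 1 ->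
  exists K r : C, [/\ 0 < K, 0 < r &
    forall w, `|w - p| < r -> w \notin b :: F -> `|phi w / blaschke b w| <= K].
Proof.
move=> phi1 db phib b1 p1.
have rp0 : 0 < 1 - `|p| by rewrite subr_gt0.
have inD w : `|w - p| < 1 - `|p| -> `|w| < 1.
  move=> h; rewrite -[w](subrK p); apply: le_lt_trans (ler_normD _ _) _.
  by rewrite -ltrBrDr.
have [pb|pb] := eqVneq p b; last first.
  have [|K [r [K0 r0 hK]]] := @cdiff_locally_bounded _ (fun w => (blaschke b w)^-1) p.
    apply: (@cdiffV _ (blaschke b)); first by rewrite blaschke_eq0.
    exact: cdiff_blaschke.
  have [s s0 [sr sp]] := pos_common_lower_bound r0 rp0.
  exists K, s; split=> // w ws; rewrite inE negb_or => /andP[_ wF].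
  rewrite normrM -[K]mul1r; apply: ler_pM => //.
    by apply: phi1 => //; apply: inD; exact: lt_le_trans ws sp.
  by apply: hK; exact: lt_le_trans ws sr.
have [K [r [K0 r0 hK]]] := cdiff_lipschitz db.
have [s s0 [sr sp]] := pos_common_lower_bound r0 rp0.
exists (K * 2), s; split=> //; first by rewrite mulr_gt0.
move=> w ws; rewrite inE negb_or => /andP[wb _].
have w1 := inD _ (lt_le_trans ws sp).
have k0 : 0 < `|w - b| by rewrite normr_gt0 subr_eq0.
have hw : `|phi w| <= K * `|w - b|.
  have := hK (w - b); rewrite [b + _]addrC subrK phib subr0; apply.
  by rewrite -pb; exact: lt_le_trans ws sr.
rewrite /blaschke invf_div normrM normrM normfV mulrA.
rewrite ler_pdivrMr// mulrAC; apply: ler_pM => //.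
apply: le_trans (ler_normB _ _) _; rewrite normr1 normrM norm_conjC.
by rewrite -[2]/(1 + 1) lerD2l mulr_ile1// ltW.
Qed.

(** The maximum principle is applied to [q ^+ m * zeros2 (b :: F)] with
    [q = phi / blaschke b], after moving [z0] to the centre by a disc automorphism
    [T]. Near the unit circle [`|blaschke b|] is close to 1, whence
    [(`|q z0| ^+ 2 * theta) ^+ m] is bounded independently of [m] for every
    [theta < 1]. *)
Lemma punctured_schwarz (R : realType) (F : seq R[i]) (phi : R[i] -> R[i]) (b z0 : R[i]) :
  (forall z : R[i], `|z| < 1 -> z \notin F -> `|phi z| <= 1) ->
  (forall z : R[i], `|z| < 1 -> z \notin F -> cdiff phi z) ->
  `|b| < 1 -> b \notin F -> phi b = 0 -> `|z0| < 1 -> z0 \notin F ->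
  `|phi z0| <= `|blaschke b z0|.
Proof.
move=> phi1 dphi b1 bF phib z01 z0F.
have [->|z0b] := eqVneq z0 b; first by rewrite phib normr0.
have bz0 : blaschke b z0 != 0 by rewrite blaschke_eq0.
pose q w := phi w / blaschke b w; pose F' := b :: F.
have z0F' : z0 \notin F' by rewrite inE negb_or z0b.
have dq w : `|w| < 1 -> w \notin F' -> cdiff q w.
  move=> w1; rewrite inE negb_or => /andP[wb wF].
  apply: cdiffM; first exact: dphi.
  apply: (@cdiffV _ (blaschke b)); first by rewrite blaschke_eq0.
  exact: cdiff_blaschke.
have du (m : nat) z : `|z| < 1 -> cdiff (fun w => q w ^+ m * zeros2 F' w) z.
  move=> z1; apply: (@cdiff_fill_punctures _ (fun w => q w ^+ m)).
    by move=> zF'; apply: (@cdiffX _ q); exact: dq.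
  move=> _; have [K [r [K0 r0 hK]]] := schwarz_quotient_bounded phi1 (dphi _ b1 bF) phib b1 z1.
  exists (K ^+ m), r; split=> //; first by rewrite exprn_gt0.
  move=> w ws wF; rewrite normrX; apply: lerXn2r; rewrite ?nnegrE ?(ltW K0)//.
  exact: hK.
(* [T] maps the disc to itself and 0 to [z0]. *)
pose T := blaschke (- z0).
have nz01 : `|- z0| < 1 by rewrite normrN.
have T0 : T 0 = z0 by rewrite /T /blaschke mulr0 subr0 sub0r opprK divr1.
pose Kb : R[i] := (1 - `|b|) ^- 2; pose Kz : R[i] := (1 - `|- z0|) ^- 2.
have Kb0 : 0 < Kb by rewrite invr_gt0 exprn_gt0// subr_gt0.
have Kz0 : 0 < Kz by rewrite invr_gt0 exprn_gt0// subr_gt0.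
have [K KE] : exists K : R, Kb * Kz = K%:C.
  by exists (complex.Re (Kb * Kz)); rewrite RRe_real// ger0_real// ltW// mulr_gt0.
have K0 : 0 < K by rewrite -ltcR -KE mulr_gt0.
pose M : R[i] := \prod_(p <- F') (1 + `|p|) ^+ 2.
pose x := normc (q z0).
have theta_bound (theta : R) : 0 < theta -> theta < 1 -> x ^+ 2 * theta <= 1.
  move=> th0 th1.
  have [r [r0 r1 rK]] : exists r : R, [/\ 0 < r, r < 1 & K * (1 - r ^+ 2) <= 1 - theta].
    set mu := Num.min (1 / 2) ((1 - theta) / (2 * K)).
    have mu1 : mu <= 1 / 2 by rewrite ge_min lexx.
    have muK : mu <= (1 - theta) / (2 * K) by rewrite ge_min lexx orbT.
    have mu0 : 0 < mu.
      by rewrite lt_min; apply/andP; split; rewrite divr_gt0 ?mulr_gt0 ?subr_gt0.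
    exists (1 - mu); split; [lra|lra|].
    move: muK; rewrite ler_pdivlMr ?mulr_gt0// => muK.
    have : 0 <= K * mu ^+ 2 by rewrite mulr_ge0 ?sqr_ge0// ltW.
    lra.
  have M0 : 0 <= M by apply: prodr_ge0 => p _; rewrite exprn_ge0// addr_ge0.
  have [c cE] : exists c : R, `|zeros2 F' z0| ^+ 2 = c%:C.
    by exists (complex.Re (`|zeros2 F' z0| ^+ 2)); rewrite RRe_real ?ger0_real ?exprn_ge0.
  have [M2 ME] : exists M2 : R, M ^+ 2 = M2%:C.
    by exists (complex.Re (M ^+ 2)); rewrite RRe_real ?ger0_real ?exprn_ge0.
  have [y yE] : exists y : R, `|q z0| = y%:C by exists x.
  have -> : x = y by apply: complexI; rewrite -yE.
  apply: (@le1_of_bounded_powers _ _ c M2).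
    by rewrite -ltcR -cE exprn_gt0// normr_gt0 zeros2_eq0.
  move=> m.
  have [|w wr] := @circle_max R (fun w => q (T w) ^+ m * zeros2 F' (T w)) r _ r0 r1.
    move=> z z1; apply: (@cdiff_comp _ T (fun w => q w ^+ m * zeros2 F' w)).
      exact: cdiff_blaschke.
    by apply: du; exact: blaschke_lt1.
  rewrite T0.
  have w1 : `|w| < 1 by rewrite wr ltcR.
  have z1 : `|T w| < 1 by exact: blaschke_lt1.
  have thb : theta%:C <= `|blaschke b (T w)| ^+ 2.
    have h1 := blaschke_defect_le b1 z1.
    have h2 := blaschke_defect_le nz01 w1.
    rewrite -lerN2 -(lerD2l 1); apply: le_trans h1 _.
    apply: le_trans (ler_wpM2l (ltW Kb0) h2) _.
    have -> : 1 - theta%:C = (1 - theta)%:C :> R[i] by rewrite rmorphB rmorph1.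
    have -> : Kb * (Kz * (1 - `|w| ^+ 2)) = (K * (1 - r ^+ 2))%:C.
      by rewrite mulrA KE wr rmorphM rmorphB rmorph1 rmorphXn.
    by rewrite lecR.
  set z := T w in z1 thb *.
  have th0C : 0 < theta%:C :> R[i] by rewrite ltcR.
  rewrite normrM normrX => le1.
  have le2 : `|q z ^+ m * zeros2 F' z| ^+ 2 * theta%:C ^+ m <= M ^+ 2.
    have [zF|zF] := boolP (z \in F').
      have /eqP -> : zeros2 F' z == 0 by rewrite zeros2_eq0.
      by rewrite mulr0 normr0 expr0n mul0r exprn_ge0.
    rewrite normrM exprMn mulrAC normrX.
    rewrite -[leRHS]mul1r; apply: ler_pM; rewrite ?mulr_ge0 ?exprn_ge0// ?(ltW th0C)//.
      rewrite -exprM mulnC exprM -exprMn; apply: exprn_ile1.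
        by rewrite mulr_ge0 ?exprn_ge0// ltW.
      apply: le_trans (ler_wpM2l _ thb) _; first by rewrite exprn_ge0.
      rewrite -exprMn -normrM exprn_ile1//.
      rewrite /q mulfVK; first by apply: phi1 => //; move: zF; rewrite inE negb_or => /andP[].
      by rewrite blaschke_eq0//; move: zF; rewrite inE negb_or => /andP[].
    by apply: lerXn2r; rewrite ?nnegrE//; exact: zeros2_le.
  rewrite -lecR -ME; apply: le_trans le2.
  have -> : ((y ^+ 2 * theta) ^+ m * c)%:C = (`|q z0| ^+ 2 * theta%:C) ^+ m * `|zeros2 F' z0| ^+ 2.
    by rewrite cE yE rmorphM rmorphXn rmorphM rmorphXn.
  rewrite exprMn mulrAC -exprM mulnC exprM -exprMn ler_wpM2r//; first by rewrite exprn_ge0// ltW.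
  by apply: lerXn2r; rewrite ?nnegrE// ?mulr_ge0// ?exprn_ge0.
have x1 : x ^+ 2 <= 1.
  rewrite leNgt; apply/negP => X1.
  have X0 : 0 < x ^+ 2 by exact: lt_trans X1.
  pose th := (1 / x ^+ 2 + 1) / 2.
  have ix0 : 0 < 1 / x ^+ 2 by rewrite divr_gt0.
  have ix1 : 1 / x ^+ 2 < 1 by rewrite ltr_pdivrMr// mul1r.
  have := theta_bound th; rewrite /th => h.
  have : x ^+ 2 * ((1 / x ^+ 2 + 1) / 2) <= 1 by apply: h; lra.
  have -> : x ^+ 2 * ((1 / x ^+ 2 + 1) / 2) = (1 + x ^+ 2) / 2.
    have x0 : x != 0 by apply: contraTneq X0 => ->; rewrite expr0n ltxx.
    by field.
  lra.
have : `|q z0| <= 1.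
  by rewrite -(expr_le1 (n := 2))// -[`|q z0|]/(x%:C) -rmorphXn lecR.
by rewrite normrM normfV ler_pdivrMr ?normr_gt0// mul1r.
Qed.

Local Close Scope complex_scope.

(** * Automorphisms of the Euclidean ball *)

Section ball.
Variables (C : numClosedFieldType) (n : nat).
Implicit Types (a v w z y : 'rV[C]_n) (c : C).

Lemma cdotDr v w z : cdot v (w + z) = cdot v w + cdot v z.
Proof. by rewrite /cdot -big_split /=; apply: eq_bigr => m _; rewrite mxE mulrDr. Qed.

Lemma cdotZr c v w : cdot v (c *: w) = c * cdot v w.
Proof. by rewrite /cdot mulr_sumr; apply: eq_bigr => m _; rewrite mxE mulrCA. Qed.

Lemma conj_cdot v w : (cdot v w)^* = cdot w v.
Proof.
rewrite /cdot rmorph_sum; apply: eq_bigr => m _.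
by rewrite rmorphM /= conjCK mulrC.
Qed.

Lemma cdotZl c v w : cdot (c *: v) w = c^* * cdot v w.
Proof. by rewrite -conj_cdot cdotZr rmorphM /= conj_cdot. Qed.

Lemma cdotBr v w z : cdot v (w - z) = cdot v w - cdot v z.
Proof. by rewrite -scaleN1r cdotDr cdotZr mulN1r. Qed.

Lemma cdotBl v w z : cdot (v - w) z = cdot v z - cdot w z.
Proof. by rewrite -conj_cdot cdotBr rmorphB /= !conj_cdot. Qed.

Lemma cdot0r v : cdot v 0 = 0.
Proof. by rewrite -[X in cdot _ X](scale0r 0) cdotZr mul0r. Qed.

Lemma cdotvv v : cdot v v = \sum_(m < n) `|v 0 m| ^+ 2.
Proof. by apply: eq_bigr => m _; rewrite normCK mulrC. Qed.

Lemma cdotvv_ge0 v : 0 <= cdot v v.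
Proof. by rewrite cdotvv sumr_ge0// => m _; rewrite exprn_ge0. Qed.

Lemma cdotvv_le0 v : cdot v v <= 0 -> v = 0.
Proof.
move=> v0; have /eqP : cdot v v = 0 by apply/le_anti; rewrite v0 cdotvv_ge0.
rewrite cdotvv psumr_eq0; last by move=> m _; rewrite exprn_ge0.
move=> /allP h; apply/rowP => m; rewrite mxE.
have := h m; rewrite mem_index_enum => /(_ isT).
by rewrite /= expf_eq0 /= normr_eq0 => /eqP.
Qed.

(** The arithmetic-geometric mean inequality, coordinate by coordinate; for vectors
    of the closed ball it replaces the Cauchy-Schwarz inequality. *)
Lemma cdot_le_mean v w : `|cdot v w| <= (cdot v v + cdot w w) / 2.
Proof.
rewrite !cdotvv -big_split /= mulr_suml.
apply: le_trans (ler_norm_sum _ _ _) _; apply: ler_sum => m _.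
rewrite normrM norm_conjC ler_pdivlMr// -subr_ge0.
rewrite (_ : _ - _ = (`|v 0 m| - `|w 0 m|) ^+ 2); last by ring.
by apply: real_exprn_even_ge0 => //; rewrite realB.
Qed.

Lemma cdot_lt1 v w : cdot v v < 1 -> cdot w w <= 1 -> `|cdot v w| < 1.
Proof.
move=> v1 w1; apply: le_lt_trans (cdot_le_mean _ _) _.
by rewrite ltr_pdivrMr// mul1r -[2]/(1 + 1) ltr_leD.
Qed.

Lemma cdot_neq1 v w : cdot v v < 1 -> cdot w w <= 1 -> 1 - cdot v w != 0.
Proof.
move=> v1 w1; rewrite subr_eq0; apply: contraTneq (cdot_lt1 v1 w1) => <-.
by rewrite normr1 ltxx.
Qed.

Definition ball_radical a : C := sqrtC (1 - cdot a a).

(** The involutive automorphism of the unit ball exchanging 0 and [a],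
    [(a - P z - s (z - P z)) / (1 - cdot a z)], where [P] is the orthogonal
    projection onto the line of [a] and [s] is [ball_radical a]. As
    [`|a| ^+ 2 = (1 - s) (1 + s)], one has
    [(1 - s) P z = cdot a z / (1 + s) *: a], a formula which covers [a = 0]. *)
Definition ball_aut a z : 'rV[C]_n :=
  (1 - cdot a z)^-1 *: (a - ball_radical a *: z - (cdot a z / (1 + ball_radical a)) *: a).

Section fixed_pole.
Variable a : 'rV[C]_n.
Hypothesis a1 : cdot a a < 1.
Let s := ball_radical a.

Lemma ball_radical_gt0 : 0 < s.
Proof. by rewrite sqrtC_gt0 subr_gt0. Qed.

Lemma conj_ball_radical : s^* = s.
Proof. by apply: conj_Creal; rewrite gtr0_real// ball_radical_gt0. Qed.

Lemma cdot_pole : cdot a a = 1 - s ^+ 2.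
Proof. by rewrite sqrtCK opprB addrC subrK. Qed.

Lemma ball_radical_neq0 : s != 0.
Proof. by rewrite gt_eqF// ball_radical_gt0. Qed.

Lemma ball_radical_succ_neq0 : 1 + s != 0.
Proof. by rewrite gt_eqF// addr_gt0// ball_radical_gt0. Qed.

Lemma ball_aut_kernel z w : 1 - cdot a z != 0 -> 1 - cdot a w != 0 ->
  1 - cdot (ball_aut a z) (ball_aut a w) =
  s ^+ 2 * (1 - cdot z w) / ((1 - cdot a z)^* * (1 - cdot a w)).
Proof.
move=> hz hw; have hz' : 1 - cdot z a != 0.
  by move: hz; rewrite -conjC_eq0 rmorphB rmorph1 /= conj_cdot.
rewrite /ball_aut -/s !(cdotZl, cdotZr, cdotBl, cdotBr) !(fmorphV, rmorphB, rmorphM, rmorphD,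
    rmorph1) /=.
rewrite !conj_cdot conj_ball_radical cdot_pole.
by field; rewrite hz' hw ball_radical_succ_neq0.
Qed.

Lemma cdot_ball_aut z : 1 - cdot a z != 0 ->
  1 - cdot a (ball_aut a z) = s ^+ 2 / (1 - cdot a z).
Proof.
move=> hz; rewrite /ball_aut -/s !(cdotZr, cdotBr) cdot_pole.
by field; rewrite hz ball_radical_succ_neq0.
Qed.

Lemma ball_autK z : 1 - cdot a z != 0 -> ball_aut a (ball_aut a z) = z.
Proof.
move=> hz; rewrite {1}/ball_aut cdot_ball_aut//.
have -> : cdot a (ball_aut a z) = 1 - s ^+ 2 / (1 - cdot a z) by rewrite -cdot_ball_aut//; ring.
rewrite /ball_aut -/s; apply/rowP => m; rewrite !mxE.
by field; rewrite hz ball_radical_neq0 ball_radical_succ_neq0.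
Qed.

Lemma ball_aut0 : ball_aut a 0 = a.
Proof. by rewrite /ball_aut cdot0r subr0 invr1 scale1r scaler0 subr0 mul0r scale0r subr0. Qed.

Lemma ball_aut_pole : ball_aut a a = 0.
Proof.
rewrite -{2}ball_aut0 ball_autK// cdot0r subr0; exact: oner_neq0.
Qed.

Lemma ball_aut_le1 z : cdot z z <= 1 -> cdot (ball_aut a z) (ball_aut a z) <= 1.
Proof.
move=> z1; have hz := cdot_neq1 a1 z1.
rewrite -subr_ge0 ball_aut_kernel// [_^* * _]mulrC -normCK.
by rewrite divr_ge0 ?exprn_ge0// mulr_ge0 ?subr_ge0// exprn_ge0// ltW// ball_radical_gt0.
Qed.

Lemma ball_aut_lt1 z : cdot z z < 1 -> cdot (ball_aut a z) (ball_aut a z) < 1.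
Proof.
move=> z1; have hz := cdot_neq1 a1 (ltW z1).
rewrite -subr_gt0 ball_aut_kernel// [_^* * _]mulrC -normCK.
rewrite divr_gt0 ?exprn_gt0 ?normr_gt0// mulr_gt0 ?subr_gt0// exprn_gt0// ball_radical_gt0//.
Qed.
End fixed_pole.
End ball.

(** * Hermitian forms on finite index sets *)

Section forms.
Variables (C : numClosedFieldType) (N : nat).
Implicit Types (M : 'I_N -> 'I_N -> C) (h x : 'I_N -> C).

Definition hform M h : C := \sum_(k < N) \sum_(l < N) (h k)^* * h l * M k l.

Lemma hform_eq M M' h h' :
  (forall k l, (h k)^* * h l * M k l = (h' k)^* * h' l * M' k l) -> hform M h = hform M' h'.
Proof. by move=> E; apply: eq_bigr => k _; apply: eq_bigr => l _. Qed.

Lemma hformD M M' h : hform (fun k l => M k l + M' k l) h = hform M h + hform M' h.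
Proof.
rewrite /hform -big_split /=; apply: eq_bigr => k _.
by rewrite -big_split /=; apply: eq_bigr => l _; rewrite mulrDr.
Qed.

Lemma hformZ c M h : hform (fun k l => c * M k l) h = c * hform M h.
Proof.
rewrite /hform mulr_sumr; apply: eq_bigr => k _.
by rewrite mulr_sumr; apply: eq_bigr => l _; rewrite mulrCA.
Qed.

Lemma hform_rank1 (u : 'I_N -> C) h :
  hform (fun k l => (u k)^* * u l) h = `|\sum_(l < N) h l * u l| ^+ 2.
Proof.
rewrite normCK mulrC rmorph_sum /= mulr_suml; apply: eq_bigr => k _.
rewrite mulr_sumr; apply: eq_bigr => l _; rewrite rmorphM /=; ring.
Qed.

Lemma hform0 M h : (forall k, h k = 0) -> hform M h = 0.
Proof.
by move=> h0; apply: big1 => k _; apply: big1 => l _; rewrite [h l]h0 mulr0 mul0r.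
Qed.

Definition point_weight (j : 'I_N) (c : C) : 'I_N -> C := fun i => if i == j then c else 0.

Lemma sum_point_weight j c (G : 'I_N -> C) : \sum_(i < N) point_weight j c i * G i = c * G j.
Proof.
rewrite (bigD1 j) //= /point_weight eqxx big1 ?addr0// => i /negbTE ->.
by rewrite mul0r.
Qed.

Lemma hform_sum M h : hform M h = \sum_(k < N) (h k)^* * (\sum_(l < N) h l * M k l).
Proof. by apply: eq_bigr => k _; rewrite mulr_sumr; apply: eq_bigr => l _; rewrite mulrA. Qed.

Lemma conj_point_weight j c i : (point_weight j c i)^* = point_weight j c^* i.
Proof. by rewrite /point_weight; case: ifP; rewrite ?rmorph0. Qed.

Lemma hform_point M j c : hform M (point_weight j c) = c^* * (c * M j j).
Proof.
rewrite hform_sum.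
under eq_bigr do rewrite sum_point_weight conj_point_weight.
by rewrite sum_point_weight.
Qed.

Lemma hform_add_point M h j c : hform M (fun i => h i + point_weight j c i) =
  hform M h + c * (\sum_(k < N) (h k)^* * M k j) + c^* * (\sum_(l < N) h l * M j l)
  + c^* * (c * M j j).
Proof.
rewrite !hform_sum.
have E k : \sum_(l < N) (h l + point_weight j c l) * M k l = \sum_(l < N) h l * M k l + c * M k j.
  by rewrite -[c * _](sum_point_weight j c (M k)) -big_split; apply: eq_bigr => l _; rewrite mulrDl.
under eq_bigr do rewrite E rmorphD /= conj_point_weight mulrDl.
rewrite big_split /= sum_point_weight mulrDr addrA; congr (_ + _ + _).
rewrite mulr_sumr -big_split; apply: eq_bigr => k _ /=; ring.
Qed.
End forms.

(** * The Schur step on the Pick form *)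

Section schur_step.
Variables (C : numClosedFieldType) (n N : nat).
Implicit Types (alpha h x : 'I_N -> C) (v w : 'I_N -> 'rV[C]_n) (j k l : 'I_N).

Definition pick_kernel alpha v k l : C := (1 - cdot (v k) (v l)) / (1 - (alpha k)^* * alpha l).

(** The Schur complement of the pivot [j] in the Pick matrix of
    [ball_aut (v j) \o v]. *)
Definition schur_defect alpha v j k l : C :=
  ((blaschke (alpha j) (alpha k))^* * blaschke (alpha j) (alpha l)
     - cdot (ball_aut (v j) (v k)) (ball_aut (v j) (v l))) / (1 - (alpha k)^* * alpha l).

(** The weights for which the Pick form of [v] at [h] becomes that of
    [ball_aut (v j) \o v], by [ball_aut_kernel]. *)
Definition schur_weight v j h k : C := h k * (1 - cdot (v j) (v k)) / ball_radical (v j).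

(** Entrywise,
    [1 - cdot g_k g_l = (1 - b_k^* b_l) + (b_k^* b_l - cdot g_k g_l)],
    and [blaschke_kernel] makes the first summand, once divided by
    [1 - alpha_k^* alpha_l], a kernel of rank one. The nonvanishing condition is
    restricted to the support of [h] because the other values may lie outside the
    ball when nodes are punctures. *)
Lemma schur_step alpha v j h : (forall k, `|alpha k| < 1) -> cdot (v j) (v j) < 1 ->
  (forall k, h k != 0 -> 1 - cdot (v j) (v k) != 0) ->
  hform (pick_kernel alpha v) h =
    (1 - (alpha j)^* * alpha j) *
      `|\sum_(l < N) schur_weight v j h l * (1 - (alpha j)^* * alpha l)^-1| ^+ 2
    + hform (schur_defect alpha v j) (schur_weight v j h).
Proof.
move=> al vj hv; set x := schur_weight v j h.
rewrite -hform_rank1 -hformZ -hformD; apply: hform_eq => k l.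
have [hk|hk] := eqVneq (h k) 0; first by rewrite /x /schur_weight hk !mul0r rmorph0 !mul0r.
have [hl|hl] := eqVneq (h l) 0; first by rewrite /x /schur_weight hl !mul0r !mulr0 !mul0r.
have dk := hv k hk; have dl := hv l hl.
have bk := disc_denom_neq0 (al j) (al k).
have bl := disc_denom_neq0 (al j) (al l).
have kl := disc_denom_neq0 (al k) (al l).
have conj_neq0 (c : C) : c != 0 -> c^* != 0 by rewrite conjC_eq0.
have Eb := blaschke_kernel bk bl.
have Eg := ball_aut_kernel vj dk dl.
have s0 := ball_radical_neq0 vj.
rewrite /schur_defect /pick_kernel.
have -> : (blaschke (alpha j) (alpha k))^* * blaschke (alpha j) (alpha l) =
  1 - (1 - (alpha j)^* * alpha j) * (1 - (alpha k)^* * alpha l) /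
     ((1 - (alpha j)^* * alpha k)^* * (1 - (alpha j)^* * alpha l)) by rewrite -Eb; ring.
have -> : cdot (ball_aut (v j) (v k)) (ball_aut (v j) (v l)) = 1 -
  ball_radical (v j) ^+ 2 * (1 - cdot (v k) (v l)) /
     ((1 - cdot (v j) (v k))^* * (1 - cdot (v j) (v l))) by rewrite -Eg; ring.
rewrite /x /schur_weight !rmorphM !fmorphV /= conj_ball_radical//.
move: (conj_neq0 _ dk) (conj_neq0 _ bk) dl bl kl s0.
move: (1 - cdot (v j) (v k))^* (1 - cdot (v j) (v l)) (1 - (alpha j)^* * alpha k)^*
  (1 - (alpha j)^* * alpha l) (1 - (alpha k)^* * alpha l) (ball_radical (v j)).
move=> A1 A2 A3 A4 A5 s a1 a3 a2 a4 a5 s0.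
by field; rewrite a1 a2 a3 a4 a5 s0.
Qed.

Lemma schur_defect_pivot_l alpha v j l : cdot (v j) (v j) < 1 -> schur_defect alpha v j j l = 0.
Proof.
move=> vj; rewrite /schur_defect ball_aut_pole// /blaschke subrr mul0r rmorph0 mul0r.
by rewrite -conj_cdot cdot0r rmorph0 subrr mul0r.
Qed.

Lemma schur_defect_pivot_r alpha v j k : cdot (v j) (v j) < 1 -> schur_defect alpha v j k j = 0.
Proof.
move=> vj; rewrite /schur_defect ball_aut_pole// /blaschke subrr mul0r mulr0.
by rewrite cdot0r subrr mul0r.
Qed.

(** The defect form does not depend on [x j], which can therefore be adjusted to
    make the linear functional of [schur_step] vanish; the Pick form is then equal
    to the defect form. *)
Lemma schur_defect_psd alpha v j (S : {set 'I_N}) x : (forall k, `|alpha k| < 1) -> j \in S ->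
  cdot (v j) (v j) < 1 -> (forall k, k \in S -> cdot (v k) (v k) <= 1) ->
  (forall h, (forall k, k \notin S -> h k = 0) -> 0 <= hform (pick_kernel alpha v) h) ->
  (forall k, k \notin S -> x k = 0) -> 0 <= hform (schur_defect alpha v j) x.
Proof.
move=> al jS vj vS psd xS.
pose e l := (1 - (alpha j)^* * alpha l)^-1.
have ej : e j != 0 by rewrite invr_eq0 disc_denom_neq0.
pose c := - (\sum_(l < N) x l * e l) / e j.
pose x' i := x i + point_weight j c i.
have -> : hform (schur_defect alpha v j) x = hform (schur_defect alpha v j) x'.
  rewrite /x' hform_add_point schur_defect_pivot_l// !mulr0 addr0.
  rewrite !big1; first by rewrite !mulr0 !addr0.
    by move=> l _; rewrite schur_defect_pivot_l// mulr0.
  by move=> k _; rewrite schur_defect_pivot_r// mulr0.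
have d k : k \in S -> 1 - cdot (v j) (v k) != 0 by move=> kS; apply: cdot_neq1 => //; exact: vS.
have s0 := ball_radical_neq0 vj.
pose h k := if k \in S then x' k * ball_radical (v j) / (1 - cdot (v j) (v k)) else 0.
have hS k : k \notin S -> h k = 0 by rewrite /h => /negbTE ->.
have wx : schur_weight v j h = x'.
  apply/funext => k; rewrite /schur_weight /h; case: ifPn => kS.
    by have dk := d k kS; field; rewrite dk s0.
  rewrite !mul0r /x' xS// /point_weight; case: eqP => [kj|_]; last by rewrite addr0.
  by rewrite kj jS in kS.
have := psd h hS; rewrite (@schur_step alpha v j h)//; last first.
  move=> k hk; apply: d; apply: contraNT hk => /hS ->; exact: eqxx.
rewrite wx; have -> : \sum_(l < N) x' l * (1 - (alpha j)^* * alpha l)^-1 = 0.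
  under eq_bigr do rewrite -/(e _) /x' mulrDl.
  rewrite big_split /= sum_point_weight /c mulfVK//.
  by rewrite addrN.
by rewrite normr0 expr0n /= mulr0 add0r.
Qed.

End schur_step.

(** * Necessity of the Pick condition *)

Section vector_cdiff.
Variables (C : numClosedFieldType) (n : nat).
Implicit Types (a u : 'rV[C]_n) (f : C -> 'rV[C]_n).

Definition vdiff f z := forall m, cdiff (fun w => f w 0 m) z.

Lemma cdiff_cdot u f z : vdiff f z -> cdiff (fun w => cdot u (f w)) z.
Proof.
move=> df; apply: (@cdiff_sum _ _ (fun m w => (u 0 m)^* * f w 0 m)) => m.
by apply: cdiffM; [exact: cdiff_cst|exact: df].
Qed.

Lemma vdiff_scale (c : C -> C) f z : cdiff c z -> vdiff f z -> vdiff (fun w => c w *: f w) z.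
Proof.
move=> dc df m; under eq_fun do rewrite mxE.
exact: cdiffM dc (df m).
Qed.

Lemma vdiff_ball_aut a f z : 1 - cdot a (f z) != 0 -> vdiff f z ->
  vdiff (fun w => ball_aut a (f w)) z.
Proof.
move=> a0 df; have dp := cdiff_cdot (u := a) df.
apply: (@vdiff_scale (fun w => (1 - cdot a (f w))^-1)).
  exact: (@cdiffV _ (fun w => 1 - cdot a (f w)) _ a0 (cdiffB (@cdiff_cst _ 1 z) dp)).
move=> m; under eq_fun do rewrite !mxE.
apply: cdiffB.
  apply: cdiffB; first exact: cdiff_cst.
  by apply: cdiffM; [exact: cdiff_cst|exact: df].
apply: cdiffM; last exact: cdiff_cst.
by apply: cdiffM; [exact: dp|exact: cdiff_cst].
Qed.

(** Positivity passes to the limit [t = 1]; if [A < B], the value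
    [t ^+ 2 = (A / B + 1) / 2] gives a contradiction. *)
Lemma scaling_limit (A B : C) :
  (forall t : C, 0 <= t < 1 -> 0 <= A - t ^+ 2 * B) -> 0 <= A - B.
Proof.
move=> h.
have A0 : 0 <= A by have := h 0; rewrite lexx ltr01 expr0n /= mul0r subr0; apply.
have Br : B \is Num.real.
  have : 0 <= A - (1 / 2) ^+ 2 * B.
    by apply: h; rewrite divr_ge0//= ltr_pdivrMr// mul1r ltr1n.
  move=> hB.
  rewrite (_ : B = (A - (A - (1 / 2) ^+ 2 * B)) * 4); last by field.
  by rewrite realM// realB// ger0_real.
rewrite subr_ge0; have := real_leVge Br (ger0_real A0) => /orP[//|].
rewrite le_eqVlt => /predU1P[->//|AB].
have B0 : 0 < B by exact: le_lt_trans A0 AB.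
have AB1 : A / B < 1 by rewrite ltr_pdivrMr// mul1r.
have AB0 : 0 <= A / B by rewrite divr_ge0// ltW.
pose s := (A / B + 1) / 2.
have s1 : s < 1 by rewrite ltr_pdivrMr// mul1r -[2]/(1 + 1) ltrD2r.
have s0 : 0 <= s by rewrite divr_ge0// addr_ge0.
have := h (sqrtC s); rewrite sqrtC_ge0 s0 sqrtCK /=.
have -> : sqrtC s < 1.
  by rewrite -(expr_lt1 (n := 2)) ?sqrtC_ge0// sqrtCK.
move=> /(_ isT); rewrite subr_ge0.
have -> : s * B = (A + B) / 2 by rewrite /s; field; rewrite gt_eqF.
rewrite ler_pdivrMr// mulr_natr mulr2n lerD2l => BA.
by have := lt_le_trans AB BA; rewrite ltxx.
Qed.
End vector_cdiff.

(** The scalar lemma applied to the component of [g] along the unit vector in the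
    direction of [g z0]. *)
Lemma vector_schwarz (R : realType) (n : nat) (F : seq R[i]) (g : R[i] -> 'rV[R[i]]_n) (b z0 :
    R[i]) :
  (forall z : R[i], `|z| < 1 -> z \notin F -> cdot (g z) (g z) <= 1 /\ vdiff g z) ->
  `|b| < 1 -> b \notin F -> g b = 0 -> `|z0| < 1 -> z0 \notin F ->
  cdot (g z0) (g z0) <= `|blaschke b z0| ^+ 2.
Proof.
move=> hg b1 bF gb z01 z0F.
pose nu := sqrtC (cdot (g z0) (g z0)).
have nu2 : nu ^+ 2 = cdot (g z0) (g z0) by rewrite sqrtCK.
have nu0 : 0 <= nu by rewrite sqrtC_ge0 cdotvv_ge0.
have [nuz|nuz] := eqVneq nu 0.
  by rewrite -nu2 nuz expr0n exprn_ge0.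
have nup : 0 < nu by rewrite lt_def nuz.
rewrite -nu2; apply: lerXn2r; rewrite ?nnegrE//.
pose u := nu^-1 *: g z0.
have uu : cdot u u = 1.
  rewrite cdotZl cdotZr -nu2 fmorphV /= (conj_Creal (gtr0_real nup)); by field.
have <- : `|cdot u (g z0)| = nu.
  rewrite cdotZl -nu2 fmorphV /= (conj_Creal (gtr0_real nup)) expr2 mulKf//.
  by rewrite ger0_norm.
apply: (@punctured_schwarz R F (fun w => cdot u (g w))) => //.
- move=> z z1 zF; apply: le_trans (cdot_le_mean _ _) _.
  rewrite uu ler_pdivrMr// mul1r -[2]/(1 + 1) lerD2l.
  by have [] := hg z z1 zF.
- by move=> z z1 zF; apply: cdiff_cdot; have [] := hg z z1 zF.
- by rewrite gb cdot0r.
Qed.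

(** Induction on the size of the support of [h], with any node of the support as
    pivot. Since the pivot value may lie on the sphere, [f] is first replaced by
    [t *: f] with [t < 1]. The quotient of the Schur step is differentiable off
    [b :: F] only, and its weights vanish at every node equal to the pivot, in
    accordance with the hypothesis on punctures. *)
Lemma pick_form_ge0 (R : realType) (n N s : nat) (alpha : 'I_N -> R[i]) :
  (forall k, `|alpha k| < 1) ->
  forall (F : seq R[i]) (f : R[i] -> 'rV[R[i]]_n) (h : 'I_N -> R[i]),
  (forall z : R[i], `|z| < 1 -> z \notin F -> cdot (f z) (f z) <= 1 /\ vdiff f z) ->
  (forall k, alpha k \in F -> h k = 0) ->
  (#|[pred k | (h k != 0)%R]| <= s)%N ->
  0 <= hform (pick_kernel alpha (fun k => f (alpha k))) h.
Proof.
move=> al; elim: s => [|s IH] F f h hf hF hs.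
  rewrite hform0// => k; apply/eqP; apply: contraT => hk.
  move: hs; rewrite leqn0 => /eqP/card0_eq/(_ k).
  by rewrite !inE hk.
have [/existsP[j hj]|] := boolP [exists j, (h j != 0)%R]; last first.
  move=> /existsPn h0; rewrite hform0// => k; apply/eqP.
  by rewrite -[_ == _]negbK; exact: h0.
have jF : alpha j \notin F by apply: contra hj => /hF ->.
pose A := hform (fun k l => 1 / (1 - (alpha k)^* * alpha l)) h.
pose B := hform (fun k l => cdot (f (alpha k)) (f (alpha l)) / (1 - (alpha k)^* * alpha l)) h.
have formE (t : R[i]) : t^* = t ->
    hform (pick_kernel alpha (fun k => t *: f (alpha k))) h = A - t ^+ 2 * B.
  move=> tr; rewrite -mulNr -hformZ -hformD; apply: hform_eq => k l.
  rewrite /pick_kernel cdotZl cdotZr tr; ring.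
have -> : hform (pick_kernel alpha (fun k => f (alpha k))) h = A - B.
  rewrite -mulN1r -hformZ -hformD; apply: hform_eq => k l.
  rewrite /pick_kernel; ring.
apply: scaling_limit => t /andP[t0 t1].
have tr : t^* = t by apply: conj_Creal; rewrite ger0_real.
rewrite -formE//; set v := fun k => t *: f (alpha k).
pose a := v j.
have tf1 z : `|z| < 1 -> z \notin F -> cdot (t *: f z) (t *: f z) < 1.
  move=> z1 zF; rewrite cdotZl cdotZr tr mulrA -expr2.
  have [fz _] := hf z z1 zF.
  apply: le_lt_trans (_ : t ^+ 2 < 1); last by rewrite expr_lt1.
  by rewrite ler_piMr// exprn_ge0.
have a1 : cdot a a < 1 by exact: tf1.
have hk_F k : h k != 0 -> alpha k \notin F by apply: contra => /hF ->.
have d0 z : `|z| < 1 -> z \notin F -> 1 - cdot a (t *: f z) != 0.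
  by move=> z1 zF; exact: (cdot_neq1 a1 (ltW (tf1 z z1 zF))).
rewrite (@schur_step _ _ _ _ _ j)//; last by move=> k /hk_F; exact: d0.
have r0 : 0 <= 1 - (alpha j)^* * alpha j.
  by rewrite mulrC -normCK subr_ge0 expr_le1// ltW.
apply: addr_ge0; first by rewrite mulr_ge0// exprn_ge0.
pose b := alpha j.
pose g z := ball_aut a (t *: f z).
have hg z : `|z| < 1 -> z \notin F -> cdot (g z) (g z) <= 1 /\ vdiff g z.
  move=> z1 zF; split; first exact: (ball_aut_le1 a1 (ltW (tf1 z z1 zF))).
  apply: (@vdiff_ball_aut _ _ a (fun z => t *: f z)); first exact: d0.
  apply: (@vdiff_scale _ _ (fun=> t)); first exact: cdiff_cst.
  by have [] := hf z z1 zF.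
have gb : g b = 0 by exact: ball_aut_pole.
pose g1 z := (blaschke b z)^-1 *: g z.
pose x := schur_weight v j h.
pose x1 k := blaschke b (alpha k) * x k.
have xh k : x k != 0 -> h k != 0.
  by apply: contra => /eqP hk; rewrite /x /schur_weight hk !mul0r.
have -> : hform (schur_defect alpha v j) x = hform (pick_kernel alpha (fun k => g1 (alpha k))) x1.
  apply: hform_eq => k l; rewrite /x1.
  have [xk|xk] := eqVneq (x k) 0; first by rewrite xk !(mulr0, rmorph0, mul0r).
  have [xl|xl] := eqVneq (x l) 0; first by rewrite xl !(mulr0, mul0r).
  rewrite /schur_defect /pick_kernel -/b -/a -/(g (alpha k)) -/(g (alpha l)).
  have -> : cdot (g1 (alpha k)) (g1 (alpha l)) = ((blaschke b (alpha k))^-1)^* *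
      ((blaschke b (alpha l))^-1 * cdot (g (alpha k)) (g (alpha l))).
    by rewrite /g1 (cdotZl (blaschke b (alpha k))^-1) (cdotZr (blaschke b (alpha l))^-1).
  have [bk|bk] := eqVneq (blaschke b (alpha k)) 0.
    have kb : alpha k = b by apply/eqP; rewrite -(blaschke_eq0 (al j) (al k)) bk.
    by rewrite bk kb gb -[cdot 0 _]conj_cdot cdot0r !(rmorph0, mul0r, mulr0, subr0).
  have [bl|bl] := eqVneq (blaschke b (alpha l)) 0.
    have lb : alpha l = b by apply/eqP; rewrite -(blaschke_eq0 (al j) (al l)) bl.
    by rewrite bl lb gb cdot0r !(rmorph0, mul0r, mulr0, subr0).
  have kl := disc_denom_neq0 (al k) (al l).
  move: (blaschke b (alpha k)) (blaschke b (alpha l)) (x k) (x l) bk bl => Bk Bl xk' xl' bk bl.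
  have bkc : Bk^* != 0 by rewrite conjC_eq0.
  rewrite !rmorphM fmorphV /=.
  by field; rewrite bkc bl kl.
apply: (IH (b :: F)).
- move=> z z1; rewrite inE negb_or => /andP[zb zF].
  have bz : blaschke b z != 0 by rewrite blaschke_eq0//; exact: al.
  split.
    rewrite cdotZl cdotZr mulrA [_^* * _]mulrC -normCK normfV -ler_pdivlMl ?exprn_gt0 ?invr_gt0
        ?normr_gt0//.
    rewrite -exprVn invrK mulr1.
    by apply: (@vector_schwarz R n F g) => //; exact: al.
  apply: (@vdiff_scale _ _ (fun z => (blaschke b z)^-1)).
    by apply: (@cdiffV _ (blaschke b)) => //; apply: cdiff_blaschke => //; exact: al.
  by have [] := hg z z1 zF.
- move=> k; rewrite inE => /orP[/eqP kb|kF].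
    by rewrite /x1 kb /blaschke subrr !mul0r.
  by rewrite /x1 /x /schur_weight hF// !mul0r mulr0.
- rewrite -ltnS; apply: leq_trans hs; apply: proper_card; apply/properP; split.
    apply/fintype.subsetP => k; rewrite !inE => xk; apply: xh; apply: contra xk => /eqP xk.
    by rewrite /x1 xk mulr0.
  exists j; rewrite !inE ?hj// negbK /x1 /b.
  by rewrite /blaschke subrr !mul0r.
Qed.

(** * Sufficiency of the Pick condition *)

Lemma vdiff_derivable (C : numClosedFieldType) (n : nat) (f : C -> 'rV[C]_n) (z : C) :
  derivable f z 1 <-> vdiff f z.
Proof.
split=> [/cvg_ex[/= l fl] m|df].
  rewrite cdiffE; apply/cvg_ex; exists (l 0 m).
  have := @cvg_comp _ _ _ _ (fun M : 'rV[C]_n => M 0 m) _ _ _ fl (@coord_continuous C 1 n 0 m l).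
  rewrite (_ : _ \o _ = fun h : C => h^-1 *: (((fun w => f w 0 m) \o shift z) (h *: 1) - f z 0 m))
      //.
  by apply/funext => h /=; rewrite !mxE.
have cvgm m : exists l : C, (fun h : C => h^-1 *: (((fun w => f w 0 m) \o shift z) (h *: 1) - f z
    0 m)) @ 0^' --> l.
  by have := df m; rewrite cdiffE => /cvg_ex[l hl]; exists l; exact: hl.
have [l hl] := choice cvgm.
apply/cvg_ex => /=; exists (\row_m l m); apply/cvg_ballP => e e0.
near=> h; split=> // i m; rewrite ord1 !mxE.
move: m; near: h; apply: filter_forall => m.
by have /cvg_ballP := hl m; apply.
Unshelve. all: by end_near. Qed.

Section sufficiency.
Variables (C : numClosedFieldType) (n N : nat) (alpha : 'I_N -> C).
Hypothesis al : forall k, `|alpha k| < 1.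
Implicit Types (v w : 'I_N -> 'rV[C]_n) (S : {set 'I_N}).

Definition pick_psd S v := forall h : 'I_N -> C,
  (forall k, k \notin S -> h k = 0) -> 0 <= hform (pick_kernel alpha v) h.

Lemma point_weight_supp S k (c : C) : k \in S -> forall i, i \notin S -> point_weight k c i = 0.
Proof.
move=> kS i iS; rewrite /point_weight; case: eqP => // ik.
by move: iS; rewrite ik kS.
Qed.

Lemma kernel_denom_gt0 k : 0 < 1 - (alpha k)^* * alpha k.
Proof. by rewrite mulrC -normCK subr_gt0 expr_lt1. Qed.

Lemma pick_psd_diag S v k : pick_psd S v -> k \in S -> cdot (v k) (v k) <= 1.
Proof.
move=> psd kS; have := psd _ (point_weight_supp 1 kS).
rewrite hform_point rmorph1 !mul1r /pick_kernel pmulr_lge0 ?subr_ge0//.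
by rewrite invr_gt0 kernel_denom_gt0.
Qed.

(** The diagonal entry at [j] vanishes, hence so do the other entries of its row,
    by positivity on the plane spanned by [j] and [k]. Thus [cdot (v j) (v k) = 1]
    and [v k - v j] has nonpositive square norm. *)
Lemma pick_psd_boundary S v j k : pick_psd S v -> j \in S -> k \in S ->
  cdot (v j) (v j) = 1 -> v k = v j.
Proof.
move=> psd jS kS vj.
pose K := pick_kernel alpha v.
have Kjj : K j j = 0 by rewrite /K /pick_kernel vj subrr mul0r.
have Kconj : K k j = (K j k)^*.
  rewrite /K /pick_kernel rmorphM fmorphV !rmorphB !rmorphM rmorph1 /= conj_cdot conjCK.
  by rewrite [alpha j * _]mulrC.
have vk := pick_psd_diag psd kS.
have Kkk : 0 <= K k k by apply: divr_ge0; [rewrite subr_ge0|exact: ltW (kernel_denom_gt0 k)].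
have Kjk : K j k = 0.
  apply/eqP; apply: contraT => K0.
  have K2 : 0 < `|K j k| ^+ 2 by rewrite exprn_gt0// normr_gt0.
  (* Each of the two cross terms equals [- (K k k + 1)]. *)
  pose c := - ((K k k + 1) / `|K j k| ^+ 2) * K j k.
  have := psd (fun i => point_weight k 1 i + point_weight j c i).
  have -> : hform (pick_kernel alpha v) (fun i => point_weight k 1 i + point_weight j c i) =
      K k k - (K k k + 1) * 2.
    rewrite hform_add_point hform_point -/K Kjj !mulr0 addr0 rmorph1 !mul1r.
    under eq_bigr do rewrite conj_point_weight.
    rewrite !sum_point_weight rmorph1 !mul1r Kconj.
    have c1 : c * (K j k)^* = - (K k k + 1).
      by rewrite /c -mulrA -normCK mulNr mulfVK// gt_eqF.
    have c2 : c^* * K j k = - (K k k + 1).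
      rewrite -[K j k in LHS]conjCK -rmorphM c1 /= conj_Creal// realN realD// ?realE ?Kkk//.
    by rewrite c1 c2; ring.
  have h0 i : i \notin S -> point_weight k 1 i + point_weight j c i = 0.
    by move=> iS; rewrite (point_weight_supp 1 kS iS) (point_weight_supp c jS iS) addr0.
  move=> /(_ h0).
  rewrite (_ : _ - _ = - (K k k + 2)); last by ring.
  by rewrite oppr_ge0 => /(lt_le_trans (ltr_wpDl Kkk (ltr0Sn _ 1))); rewrite ltxx.
have vjk : cdot (v j) (v k) = 1.
  move: Kjk => /eqP; rewrite /K /pick_kernel mulf_eq0 invr_eq0.
  rewrite (negbTE (disc_denom_neq0 (al j) (al k))) orbF subr_eq0 => /eqP <-.
  by [].
apply/eqP; rewrite -subr_eq0; apply/eqP; apply: cdotvv_le0.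
have vkj : cdot (v k) (v j) = 1 by rewrite -conj_cdot vjk rmorph1.
by rewrite !(cdotBl, cdotBr) vj vjk vkj subrr subr0 subr_le0.
Qed.

(** Induction on [S]. For an interior pivot the reduced data [w] live on the nodes
    of [S] distinct from the pivot node; at the nodes equal to it, the diagonal of
    the defect form is [- cdot (g k) (g k)] up to a positive factor, which forces
    [v k] to be the pivot value. Strictness propagates since [b f1] has norm less
    than 1 even where [f1] reaches the sphere. *)
Lemma pick_interpolant_exists S v : pick_psd S v -> exists f : C -> 'rV[C]_n,
  [/\ forall z, `|z| < 1 -> cdot (f z) (f z) <= 1 /\ vdiff f z,
      forall k, k \in S -> f (alpha k) = v k &
      forall k, k \in S -> cdot (v k) (v k) < 1 ->
        forall z, `|z| < 1 -> cdot (f z) (f z) < 1].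
Proof.
have [s] := ubnP #|S|; elim: s S v => // s IH S v; rewrite ltnS => Ss psd.
have [->|[j jS]] := set_0Vmem S.
  exists (fun=> 0); split=> [z _|k|k]; rewrite ?inE//.
  rewrite cdot0r; split=> // m.
  by under eq_fun do rewrite mxE; exact: cdiff_cst.
have vS k : k \in S -> cdot (v k) (v k) <= 1 by exact: pick_psd_diag.
pose a := v j.
have [a1|] := boolP (cdot a a < 1); last first.
  move=> aN1; have aa : cdot a a = 1.
    by have := vS j jS; rewrite le_eqVlt -/a (negbTE aN1) orbF => /eqP.
  have va k : k \in S -> v k = a by move=> kS; exact: pick_psd_boundary psd jS kS aa.
  exists (fun=> a); split=> [z _|k /va ->//|k kS].
    by rewrite aa; split=> // m; exact: cdiff_cst.
  by rewrite va// aa ltxx.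
pose b := alpha j; pose g k := ball_aut a (v k); pose B k := blaschke b (alpha k).
have dpsd x := @schur_defect_psd _ n N alpha v j S x al jS a1 vS psd.
have dk k : k \in S -> 1 - cdot a (v k) != 0 by move=> kS; apply: cdot_neq1 => //; exact: vS.
have vg k : k \in S -> ball_aut a (g k) = v k by move=> kS; rewrite ball_autK// dk.
pose S' := [set k in S | B k != 0]%SET.
have Bb k : B k = 0 -> alpha k = b by move=> h; apply/eqP; rewrite -(blaschke_eq0 (al j) (al k));
    apply/eqP.
pose w k := (B k)^-1 *: g k.
have [||f1 [f1D f1w _]] := IH S' w.
- apply: leq_trans Ss; apply: proper_card; apply/properP; split.
    by apply/fintype.subsetP => k; rewrite inE => /andP[].
  by exists j => //; rewrite inE jS /B /b /blaschke subrr mul0r eqxx.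
- move=> y yS'; pose x k := y k / B k.
  have <- : hform (schur_defect alpha v j) x = hform (pick_kernel alpha w) y.
    apply: hform_eq => k l.
    have [kS|kS] := boolP (k \in S'); last by rewrite /x (yS' k kS) !(mul0r, rmorph0).
    have [lS|lS] := boolP (l \in S'); last by rewrite /x (yS' l lS) !(mul0r, mulr0).
    move: kS lS; rewrite !inE => /andP[_ Bk] /andP[_ Bl].
    rewrite /schur_defect /pick_kernel /x -/b -/a -/(g k) -/(g l) -/(B k) -/(B l).
    have -> : cdot (w k) (w l) = ((B k)^-1)^* * ((B l)^-1 * cdot (g k) (g l)).
      by rewrite /w (cdotZl (B k)^-1) (cdotZr (B l)^-1).
    have kl := disc_denom_neq0 (al k) (al l).
    move: (B k) (B l) Bk Bl => Bk Bl bk bl.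
    have bkc : Bk^* != 0 by rewrite conjC_eq0.
    rewrite !rmorphM !fmorphV /=.
    by field; rewrite bkc bl kl.
  apply: dpsd => k kS; rewrite /x yS' ?mul0r// inE.
  by rewrite (negbTE kS).
have lt1 z : `|z| < 1 -> cdot (blaschke b z *: f1 z) (blaschke b z *: f1 z) < 1.
  move=> z1; rewrite cdotZl cdotZr mulrA [_^* * _]mulrC -normCK.
  have [fz _] := f1D z z1.
  apply: le_lt_trans (_ : `|blaschke b z| ^+ 2 < 1); last first.
    by rewrite expr_lt1// blaschke_lt1//; exact: al.
  by rewrite ler_piMr// exprn_ge0.
exists (fun z => ball_aut a (blaschke b z *: f1 z)); split.
- move=> z z1; split; first by rewrite ltW// ball_aut_lt1// lt1.
  apply: (@vdiff_ball_aut _ _ a (fun z => blaschke b z *: f1 z)).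
    exact: (cdot_neq1 a1 (ltW (lt1 z z1))).
  apply: (@vdiff_scale _ _ (blaschke b)); first by apply: cdiff_blaschke => //; exact: al.
  by have [] := f1D z z1.
- move=> k kS; have [Bk|Bk] := eqVneq (B k) 0; last first.
    rewrite f1w; last by rewrite inE kS.
    by rewrite -/(B k) /w scalerA mulfV// scale1r vg.
  rewrite -/(B k) Bk scale0r ball_aut0// -(vg k kS).
  rewrite (_ : g k = 0) ?ball_aut0//.
  apply: cdotvv_le0.
  have := dpsd _ (point_weight_supp 1 kS).
  rewrite hform_point rmorph1 !mul1r /schur_defect -/b -/a -/(g k) -/(B k) Bk mulr0 sub0r.
  by rewrite mulNr oppr_ge0 pmulr_lle0// invr_gt0 kernel_denom_gt0.
- by move=> k _ _ z z1; rewrite ball_aut_lt1// lt1.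
Qed.
End sufficiency.

Theorem theorem3p1 (R : realType) (N n : nat) (hN : (1 <= N)%N) (hn : (1 <= n)%N)
    (alpha : 'I_N -> R[i]) (v : 'I_N -> 'rV[R[i]]_n)
    (halpha : forall k, unit_disc (alpha k))
    (hv : forall k, unit_ball (v k)) :
  (exists f : R[i] -> 'rV[R[i]]_n,
      holomorphic_map unit_disc unit_ball f
      /\ forall k, f (alpha k) = v k)
  <->
  (forall h : 'I_N -> R[i],
      0 <= \sum_(k < N) \sum_(l < N)
             (h k)^* * h l
             * ((1 - cdot (v k) (v l)) / (1 - (alpha k)^* * alpha l))).
Proof.
split=> [[f [hf fv]] h|psd].
  have := @pick_form_ge0 R n N _ alpha halpha [::] f h _ _ (leqnn _).
  rewrite (_ : (fun k => f (alpha k)) = v); last exact/funext.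
  apply=> // z z1 _; have [fz dfz] := hf z z1.
  split; first by rewrite cdotvv ltW.
  exact/vdiff_derivable.
have [|f [fD fv f1]] := @pick_interpolant_exists _ n N alpha halpha [set: 'I_N]%SET v.
  by move=> h _; exact: psd.
exists f; split; last by move=> k; apply: fv; exact: finset.in_setT.
move=> z z1; split.
  rewrite /unit_ball /= -cdotvv.
  apply: (f1 (Ordinal hN)) => //.
  by rewrite cdotvv; exact: hv.
by apply/vdiff_derivable; have [] := fD z z1.
Qed.
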